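(* Let $A$ be a separable, unital $C^*$-algebra, and let $\alpha\colon\mathbb{Z}_2\to\mathrm{Aut}(A)$ be an action. Assume that $\dim^{\mathrm c}_{\mathrm{Rok}}(\alpha)\le1$ and that $A$ absorbs the UHF-algebra $M_{2^\infty}$ tensorially (that is, $A\cong A\otimes M_{2^\infty}$). Then $\alpha$ has the Rokhlin property.
   Context: $\mathbb{Z}_2$ is the cyclic group of order two. The Rokhlin property means Rokhlin dimension zero ($d=0$ in the definition below). Rokhlin dimension with commuting towers. For a $C^*$-algebra $A$, set $A_\infty=\ell^\infty(\mathbb{N},A)/c_0(\mathbb{N},A)$ with quotient map $\eta_A$; $A$ embeds via constant sequences. For a $C^*$-subalgebra $D\subseteq A$, $F(D,A)=(A_\infty\cap D')/\mathrm{Ann}(D,A_\infty)$, where $\mathrm{Ann}(D,A_\infty)$ is the annihilator of $D$ in $A_\infty$, with quotient map $\kappa_{D,A}$. For a continuous action $\alpha$ of a compact group $G$ and $D$ $\alpha$-invariant, $A_{\infty,\alpha}$ is the image under $\eta_A$ of the bounded sequences $(a_n)$ with $g\mapsto(\alpha_g(a_n))_n$ norm continuous (no condition when $G$ is finite), and $F_\alpha(D,A)=\kappa_{D,A}(A_{\infty,\alpha}\cap D')$ with induced action $F(\alpha)$. A completely positive contractive (cpc) map $\varphi$ has order zero if $\varphi(c_1)\varphi(c_2)=0$ whenever $c_1,c_2\ge0$, $c_1c_2=0$. $\dim^{\mathrm c}_{\mathrm{Rok}}(\alpha)$ is the least $d\ge 0$ such that for every $\sigma$-unital $\alpha$-invariant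 subalgebra $D\subseteq A$ there are equivariant cpc order zero maps $\varphi_0,\dots,\varphi_d\colon (C(G),\mathtt{Lt})\to (F_\alpha(D,A),F(\alpha))$ with pairwise commuting ranges and $\sum_{j}\varphi_j(1)=1$, where $\mathtt{Lt}$ is left translation; it is $\infty$ if no such $d$ exists. *)

(* Defs.v *)
From HB Require Import structures.
From mathcomp Require Import all_boot all_order all_algebra all_fingroup.
From mathcomp Require Import generic_quotient ring_quotient.
From mathcomp Require Import complex.
From mathcomp Require Import all_classical all_reals all_analysis.
From mathcomp Require Import lra.

Set Implicit Arguments.
Unset Strict Implicit.
Unset Printing Implicit Defensive.

Import Order.TTheory GRing.Theory Num.Theory.
Import numFieldNormedType.Exports.

Local Open Scope classical_set_scope.
Local Open Scope ring_scope.

(* All algebras are unital and complex, and the zero algebra is allowed (it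
   occurs among the quotients F(D, A) below).  For this reason they extend
   pzRingType and not algType, which forces 1 != 0: the scalars act through
   the central ring morphism scal, the scalar multiple of x by c being
   scal c * x.  The norm cnorm takes its values in R; normedModType cannot be
   used, as the hierarchy has no join of the normed modules with the rings. *)

HB.mixin Record isStarAlgebra (R : realType) A of GRing.PzRing A := {
  scal : R[i] -> A;
  star : A -> A;
  scal_is_zmod_morphism : zmod_morphism scal;
  scal_is_monoid_morphism : monoid_morphism scal;
  scalC : forall c x, scal c * x = x * scal c;
  starK : involutive star;
  starD : {morph star : x y / x + y};
  starM : forall x y, star (x * y) = star y * star x;
  star_scal : forall c, star (scal c) = scal (Num.conj c) }.

#[short(type="starAlgType")]
HB.structure Definition StarAlgebra (R : realType) :=
  { A of GRing.PzRing A & isStarAlgebra R A }.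

HB.instance Definition _ (R : realType) (A : starAlgType R) :=
  GRing.isZmodMorphism.Build R[i] A scal scal_is_zmod_morphism.
HB.instance Definition _ (R : realType) (A : starAlgType R) :=
  GRing.isMonoidMorphism.Build R[i] A scal scal_is_monoid_morphism.

Definition modulus (R : realType) (c : R[i]) : R := complex.Re `|c|.

HB.mixin Record isNormedStarAlgebra (R : realType) A of StarAlgebra R A := {
  cnorm : A -> R;
  cnorm_eq0 : forall x, cnorm x = 0 -> x = 0;
  cnormD : forall x y, cnorm (x + y) <= cnorm x + cnorm y;
  cnormZ : forall (c : R[i]) x, cnorm (scal c * x) = modulus c * cnorm x;
  cnormM : forall x y, cnorm (x * y) <= cnorm x * cnorm y;
  cnorm_star : forall x, cnorm (star x) = cnorm x }.

#[short(type="normedStarAlgType")]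
HB.structure Definition NormedStarAlgebra (R : realType) :=
  { A of StarAlgebra R A & isNormedStarAlgebra R A }.

HB.mixin Record isCStarAlgebra (R : realType) A of NormedStarAlgebra R A := {
  cnorm_starM : forall x : A, cnorm (star x * x) = cnorm x ^+ 2;
  cnorm_complete : forall u : nat -> A,
    (forall e : R, 0 < e -> exists N : nat, forall m n : nat,
       (N <= m)%N -> (N <= n)%N -> cnorm (u m - u n) < e) ->
    exists l : A, (fun n => cnorm (u n - l)) @ \oo --> (0 : R) }.

#[short(type="cstarAlgType")]
HB.structure Definition CStarAlgebra (R : realType) :=
  { A of NormedStarAlgebra R A & isCStarAlgebra R A }.

Section StarTheory.
Variables (R : realType) (A : starAlgType R).
Implicit Types x y : A.

Lemma star0 : star (0 : A) = 0.
Proof. by apply: (addrI (star 0)); rewrite -starD !addr0. Qed.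

Lemma starN x : star (- x) = - star x.
Proof. by apply: (addrI (star x)); rewrite -starD !subrr star0. Qed.

Lemma starB x y : star (x - y) = star x - star y.
Proof. by rewrite starD starN. Qed.

Lemma star1 : star (1 : A) = 1.
Proof. by rewrite -[LHS]mulr1 -[X in _ * X]starK -starM mulr1 starK. Qed.

Definition positive x := exists y, x = star y * y.

End StarTheory.

Section NormTheory.
Variable R : realType.
Implicit Types c : R[i].

Lemma modulusE c : (modulus c)%:C%C = `|c|.
Proof. by rewrite /modulus RRe_real ?normr_real. Qed.

Let real_complex_inj (a b : R) : a%:C%C = b%:C%C -> a = b.
Proof. by case. Qed.

Lemma modulusM c d : modulus (c * d) = modulus c * modulus d.
Proof. by apply: real_complex_inj; rewrite rmorphM !modulusE normrM. Qed.

Lemma modulus0 : modulus (0 : R[i]) = 0.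
Proof. by apply: real_complex_inj; rewrite modulusE normr0. Qed.

Lemma modulus1 : modulus (1 : R[i]) = 1.
Proof. by apply: real_complex_inj; rewrite modulusE normr1. Qed.

Lemma modulusN c : modulus (- c) = modulus c.
Proof. by apply: real_complex_inj; rewrite !modulusE normrN. Qed.

Lemma modulusJ c : modulus (Num.conj c) = modulus c.
Proof. by apply: real_complex_inj; rewrite !modulusE norm_conjC. Qed.

Lemma modulusD c d : modulus (c + d) <= modulus c + modulus d.
Proof. by rewrite -lecR rmorphD /= !modulusE ler_normD. Qed.

Lemma modulus_ge0 c : 0 <= modulus c.
Proof. by rewrite -lecR modulusE; exact: normr_ge0. Qed.

Lemma modulus_eq0 c : modulus c = 0 -> c = 0.
Proof. by move=> c0; apply/eqP; rewrite -normr_eq0 -modulusE c0. Qed.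

Variable A : normedStarAlgType R.
Implicit Types x y : A.

Lemma cnorm0 : cnorm (0 : A) = 0.
Proof. by rewrite -(mulr0 (scal 0)) cnormZ modulus0 mul0r. Qed.

Lemma cnormN x : cnorm (- x) = cnorm x.
Proof.
by rewrite -mulN1r -(rmorphN1 (@scal R A)) cnormZ modulusN modulus1 mul1r.
Qed.

Lemma cnorm_ge0 x : 0 <= cnorm x.
Proof.
by have := cnormD x (- x); rewrite subrr cnorm0 cnormN -mulr2n pmulrn_lge0.
Qed.

Definition adherent (S : set A) x :=
  forall e : R, 0 < e -> exists2 y, S y & cnorm (x - y) < e.

End NormTheory.

Definition separable (R : realType) (A : normedStarAlgType R) :=
  exists S : set A, countable S /\ forall x, adherent S x.

Section ComplexNumbers.
Variable R : realType.

Let conjM (x y : R[i]) : Num.conj (x * y) = Num.conj y * Num.conj x.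
Proof. by rewrite rmorphM mulrC. Qed.

HB.instance Definition _ := isStarAlgebra.Build R R[i]
  (fun x y => erefl (x - y)) (conj erefl (fun x y => erefl (x * y)))
  (@mulrC _) (@conjCK R[i]) (rmorphD (@Num.conj R[i])) conjM (fun c => erefl).

Let modulusM_le (x y : R[i]) : modulus (x * y) <= modulus x * modulus y.
Proof. by rewrite modulusM. Qed.

HB.instance Definition _ := isNormedStarAlgebra.Build R R[i]
  (@modulus_eq0 R) (@modulusD R) (@modulusM R) modulusM_le (@modulusJ R).

End ComplexNumbers.

Section Matrices.
Variables (R : realType) (B : starAlgType R) (n : nat).
Implicit Types X Y : 'M[B]_n.

Definition mxscal (c : R[i]) : 'M[B]_n := (scal c)%:M.
Definition mxstar X : 'M[B]_n := \matrix_(i, j) star (X j i).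

Let mxscal_zmod : zmod_morphism mxscal.
Proof. by move=> c d; rewrite /mxscal !rmorphB. Qed.

Let mxscal_monoid : monoid_morphism mxscal.
Proof.
by split=> [|c d]; rewrite /mxscal ?rmorph1 // rmorphM; exact: scalar_mxM.
Qed.

Let mxscalC c X : mxscal c * X = X * mxscal c.
Proof.
rewrite [LHS]mul_scalar_mx; apply/matrixP => i j.
rewrite [LHS]mxE [RHS]mxE (bigD1 j) //= mxE eqxx mulr1n big1 ?addr0 ?scalC //.
by move=> k kj; rewrite mxE (negPf kj) mulr0n mulr0.
Qed.

Let mxstarK : involutive mxstar.
Proof. by move=> X; apply/matrixP => i j; rewrite !mxE starK. Qed.

Let mxstarD : {morph mxstar : X Y / X + Y}.
Proof. by move=> X Y; apply/matrixP => i j; rewrite !mxE starD. Qed.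

Let mxstarM X Y : mxstar (X * Y) = mxstar Y * mxstar X.
Proof.
apply/matrixP => i j; rewrite !mxE (big_morph _ (@starD R B) (star0 B)).
by apply: eq_bigr => k _; rewrite !mxE starM.
Qed.

Let mxstar_scal c : mxstar (mxscal c) = mxscal (Num.conj c).
Proof.
apply/matrixP => i j; rewrite !mxE eq_sym.
by case: eqP => _; rewrite ?mulr1n ?mulr0n ?star_scal ?star0.
Qed.

HB.instance Definition _ := isStarAlgebra.Build R 'M[B]_n
  mxscal_zmod mxscal_monoid mxscalC mxstarK mxstarD mxstarM mxstar_scal.

End Matrices.

Section BoundedFunctions.
Variables (R : realType) (T : Type) (B : normedStarAlgType R).

Definition bounded_fct : {pred T -> B} :=
  fun f => `[< exists M : R, forall t, cnorm (f t) <= M >].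

Lemma bounded_fct_subring : subring_closed bounded_fct.
Proof.
split=> [|f g /asboolP[M fM] /asboolP[N gN]|f g /asboolP[M fM] /asboolP[N gN]].
- by apply/asboolP; exists (cnorm (1 : B)).
- apply/asboolP; exists (M + N) => t.
  by apply: (le_trans (cnormD _ _)); rewrite cnormN lerD.
- apply/asboolP; exists (M * N) => t.
  by apply: (le_trans (cnormM _ _)); rewrite ler_pM ?cnorm_ge0.
Qed.

Record bfun := BFun { bfun_val :> T -> B; bfunP : bounded_fct bfun_val }.

HB.instance Definition _ := [isSub for bfun_val].
HB.instance Definition _ := [Choice of bfun by <:].
HB.instance Definition _ := GRing.SubChoice_isSubPzRing.Build
  (T -> B) bounded_fct bfun bounded_fct_subring.

Implicit Types f g : bfun.

Lemma bfun_ext f g : (forall t, f t = g t) -> f = g.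
Proof. by move=> fg; apply: val_inj; exact: funext. Qed.

Lemma bfun_bound f : exists M : R, forall t, cnorm (f t) <= M.
Proof. exact/asboolP/bfunP. Qed.

Lemma bcst_subproof (x : B) : bounded_fct (fun=> x).
Proof. by apply/asboolP; exists (cnorm x). Qed.

Definition bcst (x : B) := BFun (bcst_subproof x).

Definition bscal (c : R[i]) := bcst (scal c).

Lemma bstar_subproof f : bounded_fct (fun t => star (f t)).
Proof.
have [M fM] := bfun_bound f.
by apply/asboolP; exists M => t; rewrite cnorm_star.
Qed.

Definition bstar f := BFun (bstar_subproof f).

Let bscal_zmod : zmod_morphism bscal.
Proof. by move=> c d; apply: bfun_ext => t; exact: rmorphB. Qed.

Let bscal_monoid : monoid_morphism bscal.
Proof.
split=> [|c d]; apply: bfun_ext => t; [exact: rmorph1|exact: rmorphM].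
Qed.

Let bscalC c f : bscal c * f = f * bscal c.
Proof. by apply: bfun_ext => t; exact: scalC. Qed.

Let bstarK : involutive bstar.
Proof. by move=> f; apply: bfun_ext => t; exact: starK. Qed.

Let bstarD : {morph bstar : f g / f + g}.
Proof. by move=> f g; apply: bfun_ext => t; exact: starD. Qed.

Let bstarM f g : bstar (f * g) = bstar g * bstar f.
Proof. by apply: bfun_ext => t; exact: starM. Qed.

Let bstar_scal c : bstar (bscal c) = bscal (Num.conj c).
Proof. by apply: bfun_ext => t; exact: star_scal. Qed.

HB.instance Definition _ := isStarAlgebra.Build R bfun
  bscal_zmod bscal_monoid bscalC bstarK bstarD bstarM bstar_scal.

Definition bnorm f : R := sup (range (fun t => cnorm (f t))).

Lemma bnorm_ub f t : cnorm (f t) <= bnorm f.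
Proof.
apply: ub_le_sup; last by exists t.
by have [M fM] := bfun_bound f; exists M => _ [s _ <-].
Qed.

Lemma bnorm_le f (M : R) :
  0 <= M -> (forall t, cnorm (f t) <= M) -> bnorm f <= M.
Proof.
move=> M0 fM; rewrite /bnorm.
have [->|/set0P ne] := eqVneq (range (fun t => cnorm (f t))) set0.
  by rewrite sup0.
by apply: ge_sup => // _ [t _ <-].
Qed.

Lemma bnorm_ge0 f : 0 <= bnorm f.
Proof.
rewrite /bnorm.
have [->|/set0P[_ [t _ _]]] := eqVneq (range (fun t => cnorm (f t))) set0.
  by rewrite sup0.
exact: le_trans (cnorm_ge0 _) (bnorm_ub f t).
Qed.

Let bnorm_eq0 f : bnorm f = 0 -> f = 0.
Proof.
move=> f0; apply: bfun_ext => t; apply: cnorm_eq0; apply/eqP.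
by rewrite eq_le cnorm_ge0 andbT -f0 bnorm_ub.
Qed.

Let bnormD f g : bnorm (f + g) <= bnorm f + bnorm g.
Proof.
apply: bnorm_le => [|t]; first by rewrite addr_ge0 ?bnorm_ge0.
by apply: (le_trans (cnormD _ _)); rewrite lerD ?bnorm_ub.
Qed.

Let bnormZ_le (c : R[i]) f : bnorm (scal c * f) <= modulus c * bnorm f.
Proof.
apply: bnorm_le => [|t]; first by rewrite mulr_ge0 ?modulus_ge0 ?bnorm_ge0.
rewrite [cnorm _](_ : _ = modulus c * cnorm (f t)); last exact: cnormZ.
by rewrite ler_wpM2l ?modulus_ge0 ?bnorm_ub.
Qed.

Let bnormZ (c : R[i]) f : bnorm (scal c * f) = modulus c * bnorm f.
Proof.
apply/eqP; rewrite eq_le bnormZ_le /=.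
have [->|c0] := eqVneq c 0; first by rewrite modulus0 mul0r bnorm_ge0.
have := bnormZ_le c^-1 (scal c * f).
rewrite mulrA -rmorphM mulVf // rmorph1 mul1r => h.
apply: (le_trans (ler_wpM2l (modulus_ge0 c) h)).
by rewrite mulrA -modulusM divff // modulus1 mul1r.
Qed.

Let bnormM f g : bnorm (f * g) <= bnorm f * bnorm g.
Proof.
apply: bnorm_le => [|t]; first by rewrite mulr_ge0 ?bnorm_ge0.
by apply: (le_trans (cnormM _ _)); rewrite ler_pM ?cnorm_ge0 ?bnorm_ub.
Qed.

Let bnorm_star f : bnorm (star f) = bnorm f.
Proof. by congr sup; apply: eq_imagel => t _; exact: cnorm_star. Qed.

HB.instance Definition _ := isNormedStarAlgebra.Build R bfun
  bnorm_eq0 bnormD bnormZ bnormM bnorm_star.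

End BoundedFunctions.

HB.mixin Record isClosedStarIdeal (R : realType) (B : normedStarAlgType R)
    (S : B -> bool) := {
  idealMl_subproof : forall a x, S x -> S (a * x);
  idealMr_subproof : forall a x, S x -> S (x * a);
  ideal_star_subproof : forall x, S x -> S (star x);
  ideal_adherent_subproof : forall x, adherent [set y | S y] x -> S x }.

#[short(type="closedStarIdeal")]
HB.structure Definition ClosedStarIdeal (R : realType)
    (B : normedStarAlgType R) :=
  { S of GRing.ZmodClosed B S & isClosedStarIdeal R B S }.

Section QuotientAlgebra.
Variables (R : realType) (B : normedStarAlgType R) (I : closedStarIdeal B).
Local Open Scope quotient_scope.

Lemma idealMl (a x : B) : x \in (I : {pred B}) -> a * x \in (I : {pred B}).
Proof. exact: idealMl_subproof. Qed.

Lemma idealMr (a x : B) : x \in (I : {pred B}) -> x * a \in (I : {pred B}).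
Proof. exact: idealMr_subproof. Qed.

Lemma ideal_star (x : B) : x \in (I : {pred B}) -> star x \in (I : {pred B}).
Proof. exact: ideal_star_subproof. Qed.

Lemma ideal_adherent (x : B) :
  adherent [set y | y \in (I : {pred B})] x -> x \in (I : {pred B}).
Proof. exact: ideal_adherent_subproof. Qed.

Definition quotalg := Quotient.quot I.

HB.instance Definition _ := GRing.Zmodule.on quotalg.

Definition qproj (x : B) : quotalg := \pi_(Quotient.quot I) x.

Definition qrepr (x : quotalg) : B := repr x.

Implicit Types x y z : quotalg.

Lemma qproj_eq (a b : B) : qproj a = qproj b <-> a - b \in (I : {pred B}).
Proof.
by rewrite Quotient.idealrBE; split=> [/eqP|] // /eqP.
Qed.

Lemma qreprK : cancel qrepr qproj.
Proof. by move=> x; exact: reprK. Qed.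

Lemma qprojP x : exists a : B, qproj a = x.
Proof. by exists (qrepr x); exact: qreprK. Qed.

Lemma qproj_zmod : zmod_morphism qproj.
Proof. by move=> a b; rewrite /qproj !piE. Qed.

HB.instance Definition _ := GRing.isZmodMorphism.Build B quotalg qproj qproj_zmod.

Definition qone : quotalg := qproj 1.
Definition qmul x y : quotalg := qproj (qrepr x * qrepr y).
Definition qscal (c : R[i]) : quotalg := qproj (scal c).
Definition qstar x : quotalg := qproj (star (qrepr x)).

Let repr_qproj (a : B) : qrepr (qproj a) - a \in (I : {pred B}).
Proof. by apply/qproj_eq; exact: qreprK. Qed.

Lemma qprojM (a b : B) : qproj (a * b) = qmul (qproj a) (qproj b).
Proof.
apply/esym/qproj_eq; set a' := qrepr _; set b' := qrepr _.
rewrite (_ : _ - _ = (a' - a) * b' + a * (b' - b)); last first.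
  by rewrite mulrBl mulrBr addrA subrK.
by apply: rpredD; [apply: idealMr|apply: idealMl]; exact: repr_qproj.
Qed.

Lemma qproj_star (a : B) : qproj (star a) = qstar (qproj a).
Proof.
by apply/esym/qproj_eq; rewrite -starB; apply: ideal_star; exact: repr_qproj.
Qed.

Let qmulA : associative qmul.
Proof.
move=> x y z; have [a <-] := qprojP x; have [b <-] := qprojP y.
by have [c <-] := qprojP z; rewrite -!qprojM mulrA.
Qed.

Let qmul1 : left_id qone qmul.
Proof. by move=> x; have [a <-] := qprojP x; rewrite -qprojM mul1r. Qed.

Let q1mul : right_id qone qmul.
Proof. by move=> x; have [a <-] := qprojP x; rewrite -qprojM mulr1. Qed.

Let qmulDl : left_distributive qmul +%R.
Proof.
move=> x y z; have [a <-] := qprojP x; have [b <-] := qprojP y.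
by have [c <-] := qprojP z; rewrite -raddfD -!qprojM mulrDl raddfD.
Qed.

Let qmulDr : right_distributive qmul +%R.
Proof.
move=> x y z; have [a <-] := qprojP x; have [b <-] := qprojP y.
by have [c <-] := qprojP z; rewrite -raddfD -!qprojM mulrDr raddfD.
Qed.

HB.instance Definition _ := GRing.Zmodule_isPzRing.Build quotalg
  qmulA qmul1 q1mul qmulDl qmulDr.

Lemma qproj_monoid : monoid_morphism qproj.
Proof. by split => // a b; rewrite qprojM. Qed.

HB.instance Definition _ :=
  GRing.isMonoidMorphism.Build B quotalg qproj qproj_monoid.

Let qscal_zmod : zmod_morphism qscal.
Proof. by move=> c d; rewrite /qscal !rmorphB. Qed.

Let qscal_monoid : monoid_morphism qscal.
Proof. by split=> [|c d]; rewrite /qscal ?rmorph1 // !rmorphM. Qed.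

Let qscalC c x : qscal c * x = x * qscal c.
Proof. by have [a <-] := qprojP x; rewrite /qscal -!rmorphM scalC. Qed.

Let qstarK : involutive qstar.
Proof. by move=> x; have [a <-] := qprojP x; rewrite -!qproj_star starK. Qed.

Let qstarD : {morph qstar : x y / x + y}.
Proof.
move=> x y; have [a <-] := qprojP x; have [b <-] := qprojP y.
by rewrite -rmorphD -!qproj_star starD rmorphD.
Qed.

Let qstarM x y : qstar (x * y) = qstar y * qstar x.
Proof.
have [a <-] := qprojP x; have [b <-] := qprojP y.
by rewrite -rmorphM -!qproj_star starM rmorphM.
Qed.

Let qstar_scal c : qstar (qscal c) = qscal (Num.conj c).
Proof. by rewrite /qscal -qproj_star star_scal. Qed.

HB.instance Definition _ := isStarAlgebra.Build R quotalg
  qscal_zmod qscal_monoid qscalC qstarK qstarD qstarM qstar_scal.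

Definition qnorm x : R := inf [set cnorm a | a in [set a | qproj a = x]].

Let qnorm_has_inf x : has_inf [set cnorm a | a in [set a | qproj a = x]].
Proof.
split; first by have [a ax] := qprojP x; exists (cnorm a), a.
by exists 0 => _ [a _ <-]; exact: cnorm_ge0.
Qed.

Lemma qnorm_lb (a : B) : qnorm (qproj a) <= cnorm a.
Proof. by apply: ge_inf; [exact: (qnorm_has_inf _).2|exists a]. Qed.

Lemma qnorm_ge x (m : R) :
  (forall a : B, qproj a = x -> m <= cnorm a) -> m <= qnorm x.
Proof.
by move=> h; apply: lb_le_inf; [exact: (qnorm_has_inf x).1|move=> _ [a /h ? <-]].
Qed.

Lemma qnorm_adherent x (e : R) :
  0 < e -> exists2 a : B, qproj a = x & cnorm a < qnorm x + e.
Proof.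
by move=> /inf_adherent /(_ (qnorm_has_inf x)) [_ [a ax <-] ae]; exists a.
Qed.

Lemma qnorm_ge0 x : 0 <= qnorm x.
Proof. by apply: qnorm_ge => a _; exact: cnorm_ge0. Qed.

Let qnorm_eq0 x : qnorm x = 0 -> x = 0.
Proof.
have [a <-] := qprojP x => a0; rewrite -(raddf0 qproj); apply/qproj_eq.
rewrite subr0; apply: ideal_adherent => e e0.
have [b ab be] := qnorm_adherent (qproj a) e0.
exists (a - b); last by rewrite opprB addrC subrK -[e]add0r -a0.
by rewrite /= -opprB rpredN; apply/qproj_eq.
Qed.

Let qnormD x y : qnorm (x + y) <= qnorm x + qnorm y.
Proof.
apply/ler_addgt0Pr => e e0.
have [a ax ae] := qnorm_adherent x (divr_gt0 e0 (ltr0n R 2)).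
have [b bx be] := qnorm_adherent y (divr_gt0 e0 (ltr0n R 2)).
rewrite -{1}ax -{1}bx -raddfD; apply: (le_trans (qnorm_lb _)).
apply: (le_trans (cnormD _ _)); rewrite [e]splitr addrACA.
by apply: lerD; exact: ltW.
Qed.

Let qnormZ_le (c : R[i]) x : qnorm (scal c * x) <= modulus c * qnorm x.
Proof.
apply/ler_addgt0Pr => e e0.
have d0 : 0 < modulus c + 1 by rewrite ltr_wpDl ?modulus_ge0.
have [a ax ae] := qnorm_adherent x (divr_gt0 e0 d0).
rewrite -{1}ax -[scal c]/(qproj (scal c)) -rmorphM.
apply: (le_trans (qnorm_lb _)); rewrite cnormZ.
apply: (le_trans (ler_wpM2l (modulus_ge0 c) (ltW ae))).
rewrite mulrDr lerD2l mulrCA -[leRHS]mulr1 ler_wpM2l ?(ltW e0) //.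
by rewrite ler_pdivrMr // mul1r lerDl.
Qed.

Let qnormZ (c : R[i]) x : qnorm (scal c * x) = modulus c * qnorm x.
Proof.
apply/eqP; rewrite eq_le qnormZ_le /=.
have [->|c0] := eqVneq c 0; first by rewrite modulus0 mul0r qnorm_ge0.
have := qnormZ_le c^-1 (scal c * x).
rewrite mulrA -rmorphM mulVf // rmorph1 mul1r => h.
apply: (le_trans (ler_wpM2l (modulus_ge0 c) h)).
by rewrite mulrA -modulusM divff // modulus1 mul1r.
Qed.

Let qnormM x y : qnorm (x * y) <= qnorm x * qnorm y.
Proof.
have qM (a : B) z : qnorm (qproj a * z) <= cnorm a * qnorm z.
  apply/ler_addgt0Pr => e e0.
  have d0 : 0 < cnorm a + 1 by rewrite ltr_wpDl ?cnorm_ge0.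
  have [b bz be] := qnorm_adherent z (divr_gt0 e0 d0).
  rewrite -{1}bz -rmorphM; apply: (le_trans (qnorm_lb _)).
  apply: (le_trans (cnormM _ _)).
  apply: (le_trans (ler_wpM2l (cnorm_ge0 a) (ltW be))).
  rewrite mulrDr lerD2l mulrCA -[leRHS]mulr1 ler_wpM2l ?(ltW e0) //.
  by rewrite ler_pdivrMr // mul1r lerDl.
apply/ler_addgt0Pr => e e0.
have d0 : 0 < qnorm y + 1 by rewrite ltr_wpDl ?qnorm_ge0.
have [a ax ae] := qnorm_adherent x (divr_gt0 e0 d0).
rewrite -{1}ax; apply: (le_trans (qM _ _)).
apply: (le_trans (ler_wpM2r (qnorm_ge0 y) (ltW ae))).
rewrite mulrDl lerD2l mulrAC -mulrA -[leRHS]mulr1 ler_wpM2l ?(ltW e0) //.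
by rewrite ler_pdivrMr // mul1r lerDl.
Qed.

Let qnorm_star_le x : qnorm (star x) <= qnorm x.
Proof.
apply: qnorm_ge => a <-; rewrite -[star _]/(qstar _) -qproj_star.
by rewrite -(cnorm_star a) qnorm_lb.
Qed.

Let qnorm_star x : qnorm (star x) = qnorm x.
Proof.
apply/eqP; rewrite eq_le qnorm_star_le /=.
by rewrite -{1}[x]starK qnorm_star_le.
Qed.

HB.instance Definition _ := isNormedStarAlgebra.Build R quotalg
  qnorm_eq0 qnormD qnormZ qnormM qnorm_star.

End QuotientAlgebra.

Section SequenceAlgebra.
Variables (R : realType) (A : normedStarAlgType R).

Definition c0_seq : {pred bfun nat A} :=
  fun a => `[< (fun n => cnorm (a n)) @ \oo --> (0 : R) >].

Let c0_le (u : nat -> R) (a : bfun nat A) :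
  u @ \oo --> (0 : R) -> (forall n, cnorm (a n) <= u n) -> a \in c0_seq.
Proof.
move=> u0 au; apply/asboolP.
apply: (@squeeze_cvgr _ _ _ _ (cst 0) u) => //; last exact: cvg_cst.
by near=> n; rewrite cnorm_ge0 au.
Unshelve. all: by end_near. Qed.

Let c0_zmod : GRing.zmod_closed c0_seq.
Proof.
split=> [|a b /asboolP a0 /asboolP b0].
  by apply: (c0_le (u := cst 0)) => [|n]; [exact: cvg_cst|rewrite cnorm0].
apply: (c0_le (u := (fun n => cnorm (a n)) \+ (fun n => cnorm (b n)))) => [|n].
  by rewrite -(addr0 0); exact: cvgD.
by apply: (le_trans (cnormD _ _)); rewrite cnormN.
Qed.

HB.instance Definition _ := GRing.isZmodClosed.Build (bfun nat A) c0_seq c0_zmod.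

Let c0Ml (a x : bfun nat A) : c0_seq x -> c0_seq (a * x).
Proof.
move=> /asboolP x0; apply: (c0_le (u := bnorm a \*o (fun n => cnorm (x n)))).
  by rewrite -(mulr0 (bnorm a)); exact: cvgMr.
move=> n; apply: (le_trans (cnormM _ _)).
by rewrite ler_wpM2r ?cnorm_ge0 ?bnorm_ub.
Qed.

Let c0Mr (a x : bfun nat A) : c0_seq x -> c0_seq (x * a).
Proof.
move=> /asboolP x0; apply: (c0_le (u := bnorm a \o* (fun n => cnorm (x n)))).
  by rewrite -(mul0r (bnorm a)); exact: cvgMl.
move=> n; apply: (le_trans (cnormM _ _)).
by rewrite ler_wpM2l ?cnorm_ge0 ?bnorm_ub.
Qed.

Let c0_star (x : bfun nat A) : c0_seq x -> c0_seq (star x).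
Proof.
move=> /asboolP x0; apply: (c0_le (u := fun n => cnorm (x n))) => // n.
by rewrite cnorm_star.
Qed.

Let c0_adherent (x : bfun nat A) : adherent [set y | c0_seq y] x -> c0_seq x.
Proof.
move=> xc; apply/asboolP/cvgrPdist_lt => e e0.
have e20 : 0 < e / 2 by rewrite divr_gt0.
have [y /asboolP /cvgrPdist_lt /(_ _ e20) y0 xy] := xc _ e20.
near=> n; have : `|0 - cnorm (y n)| < e / 2 by near: n.
rewrite !sub0r !normrN !ger0_norm ?cnorm_ge0 // => yn.
rewrite -[x n](subrK (y n)); apply: (le_lt_trans (cnormD _ _)).
rewrite [e]splitr ltrD //; apply: (le_lt_trans (bnorm_ub (x - y) n)) => //.
Unshelve. all: by end_near. Qed.

HB.instance Definition _ := isClosedStarIdeal.Build R (bfun nat A) c0_seq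
  c0Ml c0Mr c0_star c0_adherent.

Definition Ainfty := quotalg c0_seq.

HB.instance Definition _ := NormedStarAlgebra.on Ainfty.

Definition etaA (a : bfun nat A) : Ainfty := qproj c0_seq a.

Definition Ainfty_cst (x : A) : Ainfty := etaA (bcst nat x).

Lemma Ainfty_cst_star x : star (Ainfty_cst x) = Ainfty_cst (star x).
Proof.
rewrite [LHS](_ : _ = etaA (star (bcst nat x))).
  by congr etaA; apply: bfun_ext.
by rewrite /etaA qproj_star.
Qed.

End SequenceAlgebra.

(* the unit of A need not belong to a C*-subalgebra *)
Record csubalgebra (R : realType) (A : cstarAlgType R) := CSubalgebra {
  csub_set : set A;
  csub0 : csub_set 0;
  csubD : forall x y, csub_set x -> csub_set y -> csub_set (x + y);
  csubZ : forall (c : R[i]) x, csub_set x -> csub_set (scal c * x);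
  csubM : forall x y, csub_set x -> csub_set y -> csub_set (x * y);
  csub_star : forall x, csub_set x -> csub_set (star x);
  csub_closed : forall x, adherent csub_set x -> csub_set x }.

(* an approximate unit is increasing and consists of positive contractions *)
Definition sigma_unital (R : realType) (A : cstarAlgType R)
    (D : csubalgebra A) :=
  exists e : nat -> A,
    [/\ forall n,
          [/\ csub_set D (e n), positive (e n) & cnorm (e n) <= 1],
        forall n, positive (e n.+1 - e n) &
        forall d, csub_set D d -> (fun n => cnorm (e n * d - d)) @ \oo --> (0 : R) /\
                         (fun n => cnorm (d * e n - d)) @ \oo --> (0 : R)].

Section CentralSequences.
Variables (R : realType) (A : cstarAlgType R) (D : csubalgebra A).
Local Notation cst_ := (@Ainfty_cst R A).

Definition commutes_with : {pred Ainfty A} :=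
  fun x => `[< forall d, csub_set D d -> x * cst_ d = cst_ d * x >].

Lemma commutes_with_subring : subring_closed commutes_with.
Proof.
split=> [|x y /asboolP xd /asboolP yd|x y /asboolP xd /asboolP yd].
- by apply/asboolP => d Dd; rewrite mul1r mulr1.
- by apply/asboolP => d Dd; rewrite mulrBl mulrBr xd ?yd.
- by apply/asboolP => d Dd; rewrite -mulrA yd // mulrA xd // mulrA.
Qed.

Record commutant :=
  Commutant { commutant_val :> Ainfty A; commutantP : commutes_with commutant_val }.

HB.instance Definition _ := [isSub for commutant_val].
HB.instance Definition _ := [Choice of commutant by <:].
HB.instance Definition _ := GRing.SubChoice_isSubPzRing.Build
  (Ainfty A) commutes_with commutant commutes_with_subring.

Implicit Types x y : commutant.

Lemma commutant_comm x d : csub_set D d -> val x * cst_ d = cst_ d * val x.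
Proof. by move=> Dd; have /asboolP := commutantP x; apply. Qed.

Let kscal_subproof (c : R[i]) : commutes_with (scal c).
Proof. by apply/asboolP => d _; rewrite scalC. Qed.

Definition kscal c := Commutant (kscal_subproof c).

Let kstar_subproof x : commutes_with (star (val x)).
Proof.
apply/asboolP => d Dd; rewrite -[d]starK -Ainfty_cst_star -!starM.
by rewrite commutant_comm //; exact: csub_star.
Qed.

Definition kstar x := Commutant (kstar_subproof x).

Let kscal_zmod : zmod_morphism kscal.
Proof. by move=> c d; apply: val_inj; exact: rmorphB. Qed.

Let kscal_monoid : monoid_morphism kscal.
Proof. by split=> [|c d]; apply: val_inj; [exact: rmorph1|exact: rmorphM]. Qed.

Let kscalC c x : kscal c * x = x * kscal c.
Proof. by apply: val_inj; exact: scalC. Qed.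

Let kstarK : involutive kstar.
Proof. by move=> x; apply: val_inj; exact: starK. Qed.

Let kstarD : {morph kstar : x y / x + y}.
Proof. by move=> x y; apply: val_inj; exact: starD. Qed.

Let kstarM x y : kstar (x * y) = kstar y * kstar x.
Proof. by apply: val_inj; exact: starM. Qed.

Let kstar_scal c : kstar (kscal c) = kscal (Num.conj c).
Proof. by apply: val_inj; exact: star_scal. Qed.

HB.instance Definition _ := isStarAlgebra.Build R commutant
  kscal_zmod kscal_monoid kscalC kstarK kstarD kstarM kstar_scal.

Definition knorm x : R := cnorm (val x).

Let knorm_eq0 x : knorm x = 0 -> x = 0.
Proof. by move=> x0; apply: val_inj; exact: cnorm_eq0. Qed.

Let knormD x y : knorm (x + y) <= knorm x + knorm y.
Proof. exact: cnormD. Qed.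

Let knormZ (c : R[i]) x : knorm (scal c * x) = modulus c * knorm x.
Proof. exact: cnormZ. Qed.

Let knormM x y : knorm (x * y) <= knorm x * knorm y.
Proof. exact: cnormM. Qed.

Let knorm_star x : knorm (star x) = knorm x.
Proof. exact: cnorm_star. Qed.

HB.instance Definition _ := isNormedStarAlgebra.Build R commutant
  knorm_eq0 knormD knormZ knormM knorm_star.

Definition annihilator : {pred commutant} :=
  fun x => `[< forall d, csub_set D d -> val x * cst_ d = 0 /\ cst_ d * val x = 0 >].

Let annP x : reflect (forall d, csub_set D d -> val x * cst_ d = 0) (annihilator x).
Proof.
apply: (iffP (asboolP _)) => xd d Dd; first by have [] := xd d Dd.
by rewrite -commutant_comm // xd.
Qed.

Let ann_zmod : GRing.zmod_closed annihilator.
Proof.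
split=> [|x y /annP xd /annP yd]; apply/annP => d Dd; first by rewrite mul0r.
by rewrite mulrBl xd ?yd ?subrr.
Qed.

HB.instance Definition _ :=
  GRing.isZmodClosed.Build commutant annihilator ann_zmod.

Let annMl a x : annihilator x -> annihilator (a * x).
Proof. by move=> /annP xd; apply/annP => d Dd; rewrite -mulrA xd // mulr0. Qed.

Let annMr a x : annihilator x -> annihilator (x * a).
Proof.
move=> /annP xd; apply/annP => d Dd.
by rewrite -mulrA commutant_comm // mulrA xd // mul0r.
Qed.

Let ann_star x : annihilator x -> annihilator (star x).
Proof.
move=> /annP xd; apply/annP => d Dd.
rewrite [val _]/(star (val x)) -[d]starK -Ainfty_cst_star -starM.
rewrite -commutant_comm; last exact: csub_star.
by rewrite xd ?star0 //; exact: csub_star.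
Qed.

Let ann_adherent x : adherent [set y | annihilator y] x -> annihilator x.
Proof.
move=> xa; apply/annP => d Dd; apply: cnorm_eq0; apply/eqP.
rewrite eq_le cnorm_ge0 andbT; apply/ler_addgt0Pr => e e0; rewrite add0r.
have d0 : 0 < cnorm (cst_ d) + 1 by rewrite ltr_wpDl ?cnorm_ge0.
have [y /annP yd xy] := xa _ (divr_gt0 e0 d0).
rewrite -[val x](subrK (val y)) mulrDl yd // addr0.
apply: (le_trans (cnormM _ _)).
apply: (le_trans (ler_wpM2r (cnorm_ge0 _) (ltW xy))).
rewrite mulrAC -mulrA -[leRHS]mulr1 ler_wpM2l ?(ltW e0) //.
by rewrite ler_pdivrMr // mul1r lerDl.
Qed.

HB.instance Definition _ := isClosedStarIdeal.Build R commutant annihilator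
  annMl annMr ann_star ann_adherent.

Definition Fcentral := quotalg annihilator.

HB.instance Definition _ := NormedStarAlgebra.on Fcentral.

Definition kappa (x : commutant) : Fcentral := qproj annihilator x.

End CentralSequences.

Definition starhom (R : realType) (A B : starAlgType R)
    (f : {rmorphism A -> B}) :=
  (forall c : R[i], f (scal c) = scal c) /\ (forall x, f (star x) = star (f x)).

Section SquareRootTheory.
Variables (R : realType) (A : cstarAlgType R).

Lemma cnorm1_le : cnorm (1 : A) <= 1.
Proof.
have := cnorm_starM (1 : A); rewrite star1 mulr1 expr2 => h.
have [->|n0] := eqVneq (cnorm (1 : A)) 0; first exact: ler01.
by rewrite -[leLHS](mulfK n0) -h divff.
Qed.


Lemma modulus_half : modulus (2^-1 : R[i]) = 2^-1.
Proof.
have h : modulus (2 : R[i]) = 2.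
  have : (modulus (2 : R[i]))%:C%C = (2 : R)%:C%C.
    by rewrite modulusE normr_nat rmorph_nat.
  by case.
have : modulus (2^-1 : R[i]) * modulus (2 : R[i]) = 1.
  by rewrite -modulusM mulVf ?pnatr_eq0 // modulus1.
by rewrite h => /(canRL (mulfK _)) -> //; rewrite div1r.
Qed.

Let cnorm_half (x : A) : cnorm (scal 2^-1 * x) = 2^-1 * cnorm x.
Proof. by rewrite cnormZ modulus_half. Qed.

Section SquareRoot.
Variables (k : A) (k_star : star k = k) (k_le : cnorm k <= 4^-1).

Let z n := iter n (fun t => scal 2^-1 * (k + t * t)) 0.

Let zS n : z n.+1 = scal 2^-1 * (k + z n * z n). Proof. by []. Qed.

Let z_le n : cnorm (z n) <= 2^-1.
Proof.
elim: n => [|n IH]; first by rewrite cnorm0 invr_ge0.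
rewrite zS cnorm_half ler_piMr ?invr_ge0 //.
apply: (le_trans (cnormD _ _)).
have := le_trans (cnormM (z n) (z n)) (ler_pM (cnorm_ge0 _) (cnorm_ge0 _) IH IH).
by move: k_le; lra.
Qed.

Let sqB (s t : A) : cnorm (s * s - t * t) <= (cnorm s + cnorm t) * cnorm (s - t).
Proof.
rewrite (_ : _ - _ = s * (s - t) + (s - t) * t); last first.
  by rewrite mulrBr mulrBl addrA subrK.
apply: (le_trans (cnormD _ _)); rewrite [leRHS]mulrDl lerD ?cnormM //.
by rewrite [leRHS]mulrC cnormM.
Qed.

Let z_step (s t : A) : cnorm (scal 2^-1 * (k + s * s) - scal 2^-1 * (k + t * t))
  <= 2^-1 * ((cnorm s + cnorm t) * cnorm (s - t)).
Proof.
rewrite -mulrBr cnorm_half ler_wpM2l ?invr_ge0 //.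
by rewrite opprD addrACA subrr add0r sqB.
Qed.

Let z_cauchy n j : cnorm (z (n + j)%N - z n) <= 2^-1 ^+ n.
Proof.
elim: n => [|n IH].
  by rewrite subr0 expr0; apply: (le_trans (z_le _)); rewrite invf_le1 ?ler1n.
rewrite addSn !zS; apply: (le_trans (z_step _ _)).
rewrite exprS ler_wpM2l ?invr_ge0 //; apply: le_trans IH.
rewrite ler_piMl ?cnorm_ge0 //.
by have := z_le (n + j); have := z_le n; lra.
Qed.

Let z_lim : exists l : A,
  forall e : R, 0 < e -> exists n, cnorm (z n - l) < e /\ cnorm (z n.+1 - l) < e.
Proof.
have [e e0|l zl] := @cnorm_complete R A z.
  have : (fun n => 2^-1 ^+ n : R) @ \oo --> 0.
    by apply: cvg_expr; rewrite ger0_norm ?invr_ge0 // invf_lt1 ?ltr1n.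
  have e20 : 0 < e / 2 by rewrite divr_gt0.
  move=> /cvgrPdist_lt /(_ _ e20) [N _ hN]; exists N => m n Nm Nn.
  have hN' p : (N <= p)%N -> cnorm (z p - z N) < e / 2.
    move=> Np; have := hN N (leqnn N); rewrite sub0r normrN ger0_norm; last first.
      by rewrite exprn_ge0 ?invr_ge0.
    by apply: le_lt_trans; rewrite -{1}(subnKC Np) z_cauchy.
  rewrite -[z m](subrK (z N)) -addrA; apply: (le_lt_trans (cnormD _ _)).
  by rewrite [e]splitr ltrD ?hN' // -cnormN opprB hN'.
exists l => e e0; move: zl => /cvgrPdist_lt /(_ _ e0) [N _ hN]; exists N.
have := hN N (leqnn N); have := hN N.+1 (leqnSn N).
by rewrite !sub0r !normrN !ger0_norm ?cnorm_ge0.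
Qed.

Let small_eq0 (x : A) (C : R) : (forall e, 0 < e -> cnorm x <= C * e) -> x = 0.
Proof.
move=> h; apply: cnorm_eq0; apply/eqP; rewrite eq_le cnorm_ge0 andbT.
apply/ler_addgt0Pr => e e0; rewrite add0r.
have C0 : 0 < `|C| + 1 by rewrite ltr_wpDl.
apply: (le_trans (h _ (divr_gt0 e0 C0))).
rewrite mulrCA -[leRHS]mulr1 ler_wpM2l ?(ltW e0) // ler_pdivrMr // mul1r.
by rewrite (le_trans (ler_norm C)) // lerDl.
Qed.

Lemma square_root : exists y : A, [/\ star y = y, y * y = 1 - k &
  forall h, h * k = k * h -> h * y = y * h].
Proof.
have [l zl] := z_lim.
have zstar n : star (z n) = z n.
  elim: n => [|n IH]; first exact: star0.
  rewrite zS starM starD starM k_star IH star_scal scalC.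
  by congr (_ * scal _); rewrite fmorphV rmorph_nat.
have lstar : star l = l.
  apply/eqP; rewrite -subr_eq0; apply/eqP/(@small_eq0 _ 2) => e /zl[n [zn _]].
  rewrite -[star l](subrK (z n)) -addrA; apply: (le_trans (cnormD _ _)).
  by rewrite -{1}zstar -starB cnorm_star -cnormN opprB; move: zn; lra.
have lfix : l = scal 2^-1 * (k + l * l).
  apply/eqP; rewrite -subr_eq0; apply/eqP.
  apply: (@small_eq0 _ (1 + 2^-1 * (2^-1 + cnorm l))) => e e0.
  have [n [zn zn1]] := zl e e0.
  rewrite -[l in cnorm (l - _)](subrK (z n.+1)) -addrA.
  apply: (le_trans (cnormD _ _)).
  rewrite mulrDl mul1r; apply: lerD; first by rewrite -cnormN opprB ltW.
  rewrite zS; apply: (le_trans (z_step _ _)).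
  rewrite -mulrA ler_wpM2l ?invr_ge0 // ler_pM ?addr_ge0 ?cnorm_ge0 ?(ltW zn) //.
  by rewrite lerD2r.
have lcomm h : h * k = k * h -> h * l = l * h.
  move=> hk; have zcomm n : h * z n = z n * h.
    elim: n => [|n IH]; first by rewrite mulr0 mul0r.
    rewrite zS mulrA -scalC -!mulrA mulrDr mulrDl hk.
    by rewrite mulrA IH -mulrA IH mulrA.
  apply/eqP; rewrite -subr_eq0; apply/eqP.
  apply: (@small_eq0 _ (2 * cnorm h)) => e e0; have [n [zn _]] := zl e e0.
  rewrite (_ : _ - _ = h * (l - z n) + (z n - l) * h); last first.
    by rewrite mulrBr mulrBl zcomm addrA subrK.
  apply: (le_trans (cnormD _ _)).
  have := le_trans (cnormM h (l - z n)) (ler_wpM2l (cnorm_ge0 h) (ltW _)).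
  rewrite -cnormN opprB => /(_ _ zn).
  have := le_trans (cnormM (z n - l) h) (ler_wpM2r (cnorm_ge0 h) (ltW zn)).
  by lra.
exists (1 - l); split=> [||h /lcomm hl].
- by rewrite starB star1 lstar.
- have h2 : l + l = k + l * l.
    rewrite {1 2}lfix -mulrDr -mulr2n -[X in _ * X]mulr_natl mulrA.
    rewrite -(rmorph_nat (@scal R A)) -rmorphM mulVf ?pnatr_eq0 //.
    by rewrite rmorph1 mul1r.
  rewrite mulrBr mulrBl mul1r mulr1 mulrBl mul1r opprB addrAC addrA.
  rewrite -!addrA; congr (1 + _).
  have -> : k = l + l - l * l by rewrite h2 addrK.
  by rewrite !opprB !opprD !addrA addrC !addrA.
- by rewrite mulrBr mulrBl mulr1 mul1r hl.
Qed.

End SquareRoot.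

End SquareRootTheory.

(* Boundedness is what makes the termwise action on bounded sequences, and then
   on Ainfty A and F(D, A), well defined. *)
Section StarhomBounded.
Variables (R : realType) (A B : cstarAlgType R) (f : {rmorphism A -> B}).
Hypothesis f_starhom : starhom f.

Let f_small (h : A) : star h = h -> cnorm h <= 2^-1 -> cnorm (f h) <= 1.
Proof.
move=> hs h_le.
have [||y [ys y2 hy]] := @square_root R A (h * h).
- by rewrite starM hs.
- apply: (le_trans (cnormM _ _)).
  by have := ler_pM (cnorm_ge0 h) (cnorm_ge0 h) h_le h_le; lra.
have {}hy : h * y = y * h by apply: hy; rewrite mulrA.
pose u := h + scal 'i * y.
have us : star u = h - scal 'i * y.
  rewrite starD starM hs ys star_scal -scalC.
  by rewrite (_ : Num.conj 'i = - 'i) ?rmorphN ?mulNr // conjCi.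
have uu : star u * u = 1.
  rewrite us /u; set w := scal 'i * y.
  have hw : h * w = w * h by rewrite /w mulrA -[h * scal _]scalC -!mulrA hy.
  have ww : w * w = - (y * y).
    rewrite /w mulrA -[scal 'i * y * _]mulrA -[y * scal _]scalC mulrA -rmorphM.
    by rewrite -expr2 sqrCi rmorphN1 mulN1r mulNr.
  by rewrite mulrDr !mulrBl hw ww opprK addrA subrK y2 addrC subrK.
have fu : cnorm (f u) <= 1.
  have fu1 : cnorm (f u) ^+ 2 = cnorm (1 : B).
    by rewrite -cnorm_starM -f_starhom.2 -rmorphM uu rmorph1.
  have : cnorm (f u) ^+ 2 <= 1 by rewrite fu1 cnorm1_le.
  by rewrite expr_le1 // cnorm_ge0.
have -> : h = scal 2^-1 * (u + star u).
  have -> : u + star u = scal 2 * h.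
    by rewrite us addrACA subrr addr0 -mulr2n rmorph_nat mulr_natl.
  by rewrite mulrA -rmorphM mulVf ?pnatr_eq0 // rmorph1 mul1r.
rewrite rmorphM f_starhom.1 cnormZ modulus_half rmorphD f_starhom.2.
have := cnormD (f u) (star (f u)); rewrite cnorm_star.
by move: fu; lra.
Qed.

Let f_selfadj (h : A) : star h = h -> cnorm (f h) <= 2 * cnorm h.
Proof.
move=> hs; have [/cnorm_eq0 ->|n0] := eqVneq (cnorm h) 0.
  by rewrite rmorph0 cnorm0 mulr_ge0 ?cnorm_ge0.
pose r : R := (2 * cnorm h)^-1.
have r0 : 0 < 2 * cnorm h by rewrite mulr_gt0 // lt_def n0 cnorm_ge0.
have mr : modulus (r%:C%C) = r.
  have : (modulus (r%:C%C))%:C%C = r%:C%C.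
    by rewrite modulusE ger0_norm // lecR invr_ge0 ltW.
  by case.
have := f_small (h := scal r%:C%C * h).
rewrite starM hs star_scal -scalC cnormZ rmorphM f_starhom.1 cnormZ mr.
rewrite (_ : Num.conj r%:C%C = r%:C%C); last first.
  by apply: conj_Creal; apply/complex_realP; exists r.
have -> : r * cnorm h = 2^-1 by rewrite /r invfM -mulrA mulVf // mulr1.
by move=> /(_ erefl (lexx _)); rewrite ler_pdivrMl // mulr1.
Qed.

Lemma starhom_bounded (x : A) : cnorm (f x) <= 4 * cnorm x.
Proof.
pose a := x + star x; pose b := scal 'i * (star x - x).
have conji : Num.conj 'i = - 'i :> R[i] by exact: conjCi.
have modi : modulus ('i : R[i]) = 1.
  have : (modulus ('i : R[i]))%:C%C = 1%:C%C by rewrite modulusE normCi.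
  by case.
have a_self : star a = a by rewrite /a starD starK addrC.
have b_self : star b = b.
  rewrite /b starM starB starK star_scal conji -scalC rmorphN mulNr -mulrN.
  by rewrite opprB.
have a_le : cnorm a <= 2 * cnorm x.
  by apply: (le_trans (cnormD _ _)); rewrite cnorm_star -mulr2n mulr_natl.
have b_le : cnorm b <= 2 * cnorm x.
  rewrite /b cnormZ modi mul1r; apply: (le_trans (cnormD _ _)).
  by rewrite cnormN cnorm_star -mulr2n mulr_natl.
have -> : cnorm (f x) = cnorm (f (scal 2^-1 * (a + scal 'i * b))).
  have -> : a + scal 'i * b = scal 2 * x.
    rewrite /b mulrA -rmorphM -expr2 sqrCi rmorphN1 mulN1r opprB /a.
    by rewrite addrACA subrr addr0 -mulr2n rmorph_nat mulr_natl.
  by rewrite mulrA -rmorphM mulVf ?pnatr_eq0 // rmorph1 mul1r.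
rewrite rmorphM f_starhom.1 cnormZ modulus_half rmorphD rmorphM f_starhom.1.
have := cnormD (f a) (scal 'i * f b); rewrite cnormZ modi mul1r.
have := f_selfadj a_self; have := f_selfadj b_self.
by move: a_le b_le; lra.
Qed.

End StarhomBounded.

Record cstar_action (R : realType) (gT : finGroupType) (A : cstarAlgType R) :=
  CstarAction {
    act :> gT -> {rmorphism A -> A};
    act_starhom : forall g, starhom (act g);
    act1 : forall x, act 1%g x = x;
    actM : forall g h x, act (g * h)%g x = act g (act h x) }.

Definition act_invariant (R : realType) (gT : finGroupType) (A : cstarAlgType R)
    (alpha : cstar_action gT A) (D : csubalgebra A) :=
  forall g d, csub_set D d -> csub_set D (alpha g d).

Section InducedAction.
Variables (R : realType) (gT : finGroupType) (A : cstarAlgType R).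
Variable alpha : cstar_action gT A.

Let seq_act_subproof g (a : bfun nat A) : bounded_fct (fun n => alpha g (a n)).
Proof.
have [M aM] := bfun_bound a; apply/asboolP; exists (4 * M) => n.
apply: (le_trans (starhom_bounded (act_starhom alpha g) _)).
by rewrite ler_wpM2l.
Qed.

Definition seq_act g (a : bfun nat A) : bfun nat A := BFun (seq_act_subproof g a).

Definition Ainfty_act g (x : Ainfty A) : Ainfty A := etaA (seq_act g (qrepr x)).

Lemma Ainfty_act_eta g (a : bfun nat A) :
  Ainfty_act g (etaA a) = etaA (seq_act g a).
Proof.
apply/qproj_eq; set b := qrepr _.
have /asboolP ba : b - a \in @c0_seq R A by apply/qproj_eq; exact: qreprK.
apply/asboolP; apply: (@squeeze_cvgr _ _ _ _ (cst 0)
    (4 \*o (fun n => cnorm ((b - a) n)))); last 2 first.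
- exact: cvg_cst.
- by rewrite -(mulr0 4); exact: cvgMr.
near=> n; rewrite cnorm_ge0 /=.
rewrite [X in cnorm X](_ : _ = alpha g ((b - a) n)).
  exact: starhom_bounded (act_starhom alpha g) _.
by rewrite [RHS]rmorphB.
Unshelve. all: by end_near. Qed.

Lemma Ainfty_act_cst g d : Ainfty_act g (Ainfty_cst d) = Ainfty_cst (alpha g d).
Proof. by rewrite Ainfty_act_eta; congr etaA; apply: bfun_ext. Qed.

Lemma Ainfty_actM g (x y : Ainfty A) :
  Ainfty_act g (x * y) = Ainfty_act g x * Ainfty_act g y.
Proof.
have [a <-] := qprojP x; have [b <-] := qprojP y; rewrite -rmorphM.
rewrite !Ainfty_act_eta -[RHS](rmorphM (qproj (@c0_seq R A))); congr etaA.
by apply: bfun_ext => n; exact: rmorphM.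
Qed.

Lemma Ainfty_actB g (x y : Ainfty A) :
  Ainfty_act g (x - y) = Ainfty_act g x - Ainfty_act g y.
Proof.
have [a <-] := qprojP x; have [b <-] := qprojP y; rewrite -rmorphB.
rewrite !Ainfty_act_eta -[RHS](rmorphB (qproj (@c0_seq R A))); congr etaA.
by apply: bfun_ext => n; exact: rmorphB.
Qed.

Variables (D : csubalgebra A) (Dinv : act_invariant alpha D).

Let act_invariantP g d : csub_set D d ->
  exists2 d', csub_set D d' & d = alpha g d'.
Proof.
move=> Dd; exists (alpha g^-1%g d); first exact: Dinv.
by rewrite -actM mulgV act1.
Qed.

Let commutant_act_subproof g (x : commutant D) :
  commutes_with D (Ainfty_act g (val x)).
Proof.
apply/asboolP => d /(act_invariantP g)[d' Dd' ->].
by rewrite -Ainfty_act_cst -!Ainfty_actM commutant_comm.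
Qed.

Definition commutant_act g (x : commutant D) : commutant D :=
  Commutant (commutant_act_subproof g x).

(* the action F(alpha) on F(D, A); as the group is finite, all of Ainfty A is
   continuous for the action, that is F_alpha(D, A) = F(D, A) *)
Definition Fcentral_act g (z : Fcentral D) : Fcentral D :=
  kappa (commutant_act g (qrepr z)).

Lemma Fcentral_act_kappa g (x : commutant D) :
  Fcentral_act g (kappa x) = kappa (commutant_act g x).
Proof.
apply/qproj_eq; set y := qrepr _.
have /asboolP yx : y - x \in @annihilator R A D by apply/qproj_eq; exact: qreprK.
apply/asboolP => d /(act_invariantP g)[d' Dd' ->].
rewrite -Ainfty_act_cst [val _](_ : _ = Ainfty_act g (val (y - x))); last first.
  by rewrite [RHS]Ainfty_actB.
have [yx1 yx2] := yx _ Dd'; rewrite -!Ainfty_actM yx1 yx2.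
by have := Ainfty_actB g 0 0; rewrite !subrr => ->.
Qed.

End InducedAction.

Section OrderZero.
Variables (R : realType) (B F : normedStarAlgType R) (phi : B -> F).

Definition clinear :=
  (forall x y, phi (x + y) = phi x + phi y) /\
  (forall (c : R[i]) x, phi (scal c * x) = scal c * phi x).

Definition completely_positive :=
  forall n (X : 'M[B]_n), positive X -> positive (map_mx phi X).

Definition contractive := forall x, cnorm (phi x) <= cnorm x.

Definition order_zero := forall c1 c2 : B,
  positive c1 -> positive c2 -> c1 * c2 = 0 -> phi c1 * phi c2 = 0.

Definition cpc_order_zero :=
  [/\ clinear, completely_positive, contractive & order_zero].

End OrderZero.

Section RokhlinDimension.
Variables (R : realType) (gT : finGroupType).

(* C(G): as G is finite and discrete, every function on G is bounded and
   continuous *)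
Definition CG := bfun gT R[i].

HB.instance Definition _ := NormedStarAlgebra.on CG.

Let left_translation_subproof g (f : CG) : bounded_fct (fun h => f (g^-1 * h)%g).
Proof. by have [M fM] := bfun_bound f; apply/asboolP; exists M. Qed.

Definition left_translation g (f : CG) : CG := BFun (left_translation_subproof g f).

Variables (A : cstarAlgType R) (alpha : cstar_action gT A).

Definition rokhlin_towers (d : nat) :=
  forall D : csubalgebra A, sigma_unital D ->
  forall Dinv : act_invariant alpha D,
  exists phi : 'I_d.+1 -> CG -> Fcentral D,
    [/\ forall j, cpc_order_zero (phi j),
        forall j g f, phi j (left_translation g f) = Fcentral_act Dinv g (phi j f),
        forall i j, i != j -> forall f h, phi i f * phi j h = phi j h * phi i f &
        \sum_j phi j 1 = 1].

Definition dimRokc : \bar R :=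
  ereal_inf [set (d%:R)%:E | d in rokhlin_towers].

Definition rokhlin_property := dimRokc = 0%:E.

End RokhlinDimension.

Section Absorption.
Variable R : realType.

(* B is the UHF algebra of type 2^oo: the closure of the union of an increasing
   sequence of unital *-subalgebras isomorphic to the matrix algebras of sizes
   2 ^ n *)
Definition UHF_2infty (B : cstarAlgType R) :=
  exists theta : forall n : nat, {rmorphism 'M[R[i]]_(2 ^ n) -> B},
    [/\ forall n, starhom (theta n),
        forall n, injective (theta n),
        forall n, range (theta n) `<=` range (theta n.+1) &
        forall b, adherent (\bigcup_n range (theta n)) b].

(* T is a tensor product of A and B: the completion of the algebraic tensor
   product for a C*-norm.  The last two conditions say that the *-homomorphism
   from the algebraic tensor product to T induced by i and j is injective and
   has a dense range.  The norm is unique as soon as A or B is nuclear, which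
   is the case of UHF algebras. *)
Definition cstar_tensor (A B T : cstarAlgType R) :=
  exists (i : {rmorphism A -> T}) (j : {rmorphism B -> T}),
    [/\ starhom i /\ starhom j,
        forall a b, i a * j b = j b * i a,
        forall n (a : 'I_n -> A) (b : 'I_n -> B),
          (forall c : 'I_n -> R[i],
             \sum_k scal (c k) * b k = 0 -> forall k, c k = 0) ->
          \sum_k i (a k) * j (b k) = 0 -> forall k, a k = 0 &
        forall t, adherent [set t | exists n (a : 'I_n -> A) (b : 'I_n -> B),
          t = \sum_k i (a k) * j (b k)] t].

Definition cstar_isomorphic (A B : cstarAlgType R) :=
  exists f : {rmorphism A -> B}, starhom f /\ bijective f.

Definition absorbs (A B : cstarAlgType R) :=
  exists T : cstarAlgType R, cstar_tensor A B T /\ cstar_isomorphic A T.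

Definition absorbs_UHF_2infty (A : cstarAlgType R) :=
  exists B : cstarAlgType R, UHF_2infty B /\ absorbs A B.

End Absorption.

(* Main.v *)
(* Let Q = A_oo and let f be the involution of Q induced by the generator of
   Z_2.  Commuting towers with d = 1 and D = A give central selfadjoint elements
   e0, e1, k0, k1 of Q with e0 e1 = 0 = k0 k1 and sum 1, exchanged in pairs by f;
   they parametrize the join of two copies of Z_2, a circle with its antipodal
   action.  As A absorbs the UHF algebra, there are central anticommuting
   symmetries s, t and s', t' commuting with these elements, s', t' moreover
   commuting with s, t, f(s), f(t).  The elements x = e0 t + e1 f(t) and
   y = e0 s - e1 f(s) are selfadjoint, anticommute, satisfy
   x^2 = y^2 = (e0 + e1)^2, and f(x) = x, f(y) = - y; likewise for x', y' built
   from k0, k1, s', t'.  The product S = (x + i x')(y' + i y) is then selfadjoint,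
   f(S) = - S, and S^2 is the square of the invertible element
   (e0 + e1)^2 + (k0 + k1)^2, so that normalizing S gives a central symmetry W
   with f(W) = - W.  Its spectral projections (1 + W) / 2 and (1 - W) / 2 are
   exchanged by f, which is the Rokhlin property. *)

From HB Require Import structures.
Require Import Defs.
From mathcomp Require Import all_boot all_order all_algebra all_fingroup.
From mathcomp Require Import complex.
From mathcomp Require Import all_classical all_reals all_analysis.
From mathcomp Require Import ring lra.

Set Implicit Arguments.
Unset Strict Implicit.
Unset Printing Implicit Defensive.

Import Order.TTheory GRing.Theory Num.Theory.
Import numFieldNormedType.Exports.

Local Open Scope classical_set_scope.
Local Open Scope ring_scope.

(** * Scalars and pairs of anticommuting symmetries *)

Section Scalars.
Variables (R : realType) (Q : starAlgType R).

Lemma scal_half_double (x : Q) : scal 2^-1 * (x + x) = x.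
Proof.
rewrite mulrDr -mulrDl -rmorphD; have -> : 2^-1 + 2^-1 = 1 :> R[i] by field.
by rewrite rmorph1 mul1r.
Qed.

Lemma mulr_scal (c d : R[i]) (x y : Q) :
  scal c * x * (scal d * y) = scal (c * d) * (x * y).
Proof. by rewrite rmorphM -!mulrA [x * (_ * _)]mulrA -scalC !mulrA. Qed.

Lemma scal_ii : scal 'i * scal 'i = -1 :> Q.
Proof. by rewrite -rmorphM -expr2 sqrCi rmorphN1. Qed.

Lemma star_scal_i : star (scal 'i) = - scal 'i :> Q.
Proof. by rewrite star_scal conjCi rmorphN. Qed.

Lemma mul_gauss (u v u' v' : Q) : (u + scal 'i * v) * (u' + scal 'i * v') =
  (u * u' - v * v') + scal 'i * (u * v' + v * u').
Proof.
have ir (a b : Q) : a * (scal 'i * b) = scal 'i * (a * b).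
  by rewrite mulrA -scalC mulrA.
rewrite mulrDl !mulrDr ir -!mulrA ir [scal 'i * (scal 'i * _)]mulrA scal_ii mulN1r.
by rewrite [X in _ + X]addrC addrACA -mulrDr.
Qed.

Lemma mul_gaussB (u v u' v' : Q) : (u + scal 'i * v) * (u' - scal 'i * v') =
  (u * u' + v * v') + scal 'i * (v * u' - u * v').
Proof.
by rewrite -[scal 'i * v']opprK -!mulrN mul_gauss !mulrN !opprK [_ + v * u']addrC.
Qed.

End Scalars.

(** The relations of two Pauli matrices: with 1 and [s * t], such a pair spans a unital image of the
    2 x 2 matrices. *)
Record pauli_pair (R : realType) (Z : starAlgType R) (s t : Z) : Prop := PauliPair {
  pauli_star : star s = s;
  pauli_start : star t = t;
  pauli_sq : s * s = 1;
  pauli_sqt : t * t = 1;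
  pauli_anti : s * t = - (t * s) }.

Section OddSelfadjoint.
Variables (R : realType) (Q : starAlgType R) (f : {rmorphism Q -> Q}).
Hypotheses (f_starhom : starhom f) (fK : involutive f).

(** What is kept of an equivariant order zero map on C(Z_2): [e0] and [e1] are the images of the two
    point masses. *)
Record odd_tower (e0 e1 : Q) : Prop := OddTower {
  tower_star : star e0 = e0;
  tower_swap : f e0 = e1;
  tower_orth : e0 * e1 = 0 }.

(** Orthogonality of [e0] and [e1] kills every product that mixes [s], [t] with [f s], [f t]: the
    elements [x] and [y] act as [t] and [s] on the first weight, as [f t] and [- f s] on the second.
    The sign in [y] makes it odd and is harmless for anticommutation. *)
Lemma weighted_pauli (e0 e1 s t : Q) :
    odd_tower e0 e1 -> pauli_pair s t ->
    (forall z, z \in [:: s; t] -> GRing.comm e0 z) ->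
    (forall z, z \in [:: s; t] -> GRing.comm e1 z) ->
  let x := e0 * t + e1 * f t in let y := e0 * s - e1 * f s in
  [/\ [/\ star x = x, star y = y, f x = x & f y = - y],
      x * x = (e0 + e1) * (e0 + e1), y * y = (e0 + e1) * (e0 + e1)
      & x * y = - (y * x)].
Proof.
move=> [e0s fe0 e01] [ss ts s2 t2 st] c0 c1 x y.
have fe1 : f e1 = e0 by rewrite -fe0 fK.
have e1s : star e1 = e1 by rewrite -fe0 -f_starhom.2 e0s.
have e10 : e1 * e0 = 0 by rewrite -fe0 -{2}fe1 -rmorphM e01 rmorph0.
have c0s : e0 * s = s * e0 by apply: c0; rewrite !inE eqxx.
have c0t : e0 * t = t * e0 by apply: c0; rewrite !inE eqxx orbT.
have c1s : e1 * s = s * e1 by apply: c1; rewrite !inE eqxx.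
have c1t : e1 * t = t * e1 by apply: c1; rewrite !inE eqxx orbT.
(* As [f] exchanges [e0] and [e1], it carries commutation with [s], [t] over to [f s], [f t]. *)
have c0fs : e0 * f s = f s * e0 by rewrite -fe1 -!rmorphM c1s.
have c0ft : e0 * f t = f t * e0 by rewrite -fe1 -!rmorphM c1t.
have c1fs : e1 * f s = f s * e1 by rewrite -fe0 -!rmorphM c0s.
have c1ft : e1 * f t = f t * e1 by rewrite -fe0 -!rmorphM c0t.
have aa : (e0 + e1) * (e0 + e1) = e0 * e0 + e1 * e1.
  by rewrite mulrDl !mulrDr e01 e10 addr0 add0r.
have prod a b c d : e0 * a = a * e0 -> e1 * c = c * e1 -> e1 * a = a * e1 ->
    e0 * c = c * e0 ->
    (e0 * a + e1 * c) * (e0 * b + e1 * d) = e0 * e0 * (a * b) + e1 * e1 * (c * d).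
  move=> h1 h2 h3 h4; rewrite mulrDl !mulrDr.
  rewrite -!mulrA [a * (e0 * _)]mulrA -h1 -!mulrA.
  rewrite [a * (e1 * _)]mulrA -h3 [c * (e0 * _)]mulrA -h4.
  rewrite [c * (e1 * _)]mulrA -h2 -!mulrA.
  by rewrite [e0 * (e1 * _)]mulrA e01 [e1 * (e0 * _)]mulrA e10 !mul0r addr0 add0r.
have cN : e1 * - f s = - f s * e1 by rewrite mulrN c1fs mulNr.
have cN0 : e0 * - f s = - f s * e0 by rewrite mulrN c0fs mulNr.
have yE : y = e0 * s + e1 * - f s by rewrite /y mulrN.
split.
- split.
  + by rewrite /x starD !starM -f_starhom.2 ts e0s e1s c0t c1ft.
  + by rewrite /y starB !starM -f_starhom.2 ss e0s e1s c0s c1fs.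
  + by rewrite /x rmorphD !rmorphM fe0 fe1 fK addrC.
  + by rewrite /y rmorphB !rmorphM fe0 fe1 fK opprB.
- by rewrite /x prod // -rmorphM t2 rmorph1 !mulr1 aa.
- by rewrite yE prod // mulrNN -rmorphM s2 rmorph1 !mulr1 aa.
- rewrite yE /x !prod // mulrN mulNr -!rmorphM st rmorphN opprK.
  by rewrite opprD !mulrN !opprK.
Qed.

(* [S = P T] with [P = x + i x'] and [T = y' + i y] is also [T^* P^*], while
   [P P^* = T T^* = a + a']. *)
Lemma twisted_product (x y x' y' a a' : Q) :
    [/\ star x = x, star y = y, f x = x & f y = - y] ->
    [/\ star x' = x', star y' = y', f x' = x' & f y' = - y'] ->
    x * x = a -> y * y = a -> x * y = - (y * x) ->
    x' * x' = a' -> y' * y' = a' -> x' * y' = - (y' * x') ->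
    x * x' = x' * x -> x * y' = y' * x -> y * x' = x' * y -> y * y' = y' * y ->
  let S := (x + scal 'i * x') * (y' + scal 'i * y) in
  [/\ star S = S, f S = - S & S * S = (a + a') * (a + a')].
Proof.
move=> [sx sy fx fy] [sx' sy' fx' fy'] xx yy xy xx' yy' xy' xx'c xy'c yx'c yy'c S.
have SE : S = (y' - scal 'i * y) * (x - scal 'i * x').
  rewrite -!mulrN mul_gauss /S mul_gauss mulrNN mulrN mulNr xy xy' xy'c -yx'c.
  by congr (_ + _ * _); rewrite addrC.
have sS : star S = S.
  rewrite [RHS]SE /S starM !starD !starM star_scal_i sx sy sx' sy'.
  by rewrite !mulrN -!scalC.
have nP : (x + scal 'i * x') * (x - scal 'i * x') = a + a'.
  by rewrite mul_gaussB xx xx' xx'c subrr mulr0 addr0.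
have nT : (y' + scal 'i * y) * (y' - scal 'i * y) = a + a'.
  by rewrite mul_gaussB yy yy' yy'c subrr mulr0 addr0 addrC.
have Pa : (x + scal 'i * x') * (a + a') = (a + a') * (x + scal 'i * x').
  have ca : x * (a + a') = (a + a') * x.
    by rewrite mulrDr mulrDl -xx -xx' !mulrA xx'c -!mulrA xx'c.
  have ca' : x' * (a + a') = (a + a') * x'.
    by rewrite mulrDr mulrDl -xx -xx' !mulrA -xx'c -!mulrA -xx'c.
  by rewrite mulrDl -mulrA ca' ca mulrA scalC -mulrA mulrDr.
split=> //.
  rewrite /S rmorphM !rmorphD !rmorphM f_starhom.1 fx fx' fy fy'.
  by rewrite mulrN -opprD mulrN.
(* The two forms of [S] give S S = P T T^* P^* = P (a + a') P^*, and P commutes with a + a'. *)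
rewrite {1}/S SE -!mulrA [X in _ * X]mulrA nT.
by rewrite mulrA Pa -mulrA nP.
Qed.

End OddSelfadjoint.

(** * The norm of the sequence algebra *)

Section CStarNorm.
Variables (R : realType) (A : cstarAlgType R).

Lemma scal_real_star (r : R) : star (scal r%:C%C) = scal r%:C%C :> A.
Proof.
by rewrite star_scal; congr scal; apply: conj_Creal; apply/complex_realP; exists r.
Qed.

Lemma modulus_real (r : R) : modulus r%:C%C = `|r|.
Proof.
have : (modulus (r%:C%C))%:C%C = `|r|%:C%C.
  by rewrite modulusE normc_def /= expr0n addr0 sqrtr_sqr.
by case.
Qed.

Lemma modulus_i : modulus ('i : R[i]) = 1.
Proof.
have : (modulus ('i : R[i]))%:C%C = 1%:C%C by rewrite modulusE normCi.
by case.
Qed.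

Lemma cnorm_unitary (u : A) : star u * u = 1 -> cnorm u <= 1.
Proof.
move=> uu; have : cnorm u ^+ 2 <= 1 by rewrite -cnorm_starM uu cnorm1_le.
by rewrite expr_le1 // cnorm_ge0.
Qed.

(* [1 - b^2] is the square of the imaginary part of the unitary
   [b + i sqrt (1 - b^2)]. *)
Lemma cnorm_1Bsq (b : A) : star b = b -> cnorm b <= 2^-1 -> cnorm (1 - b * b) <= 1.
Proof.
move=> bs b_le; have [||y [ys y2 by_]] := @square_root R A (b * b).
- by rewrite starM bs.
- apply: (le_trans (cnormM _ _)).
  by have := ler_pM (cnorm_ge0 b) (cnorm_ge0 b) b_le b_le; lra.
have {}by_ : b * y = y * b by apply: by_; rewrite mulrA.
pose u := b + scal 'i * y.
have us : star u = b - scal 'i * y.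
  by rewrite starD starM bs ys star_scal_i mulrN -scalC.
have u1 : cnorm u <= 1.
  apply: cnorm_unitary.
  have -> : star u = b + scal 'i * - y by rewrite us mulrN.
  by rewrite mul_gauss mulNr y2 mulNr by_ subrr mulr0 addr0 opprK addrC subrK.
have yE : scal 'i * y = scal 2^-1 * (u - star u).
  by rewrite us /u opprB [b + _]addrC addrACA subrr addr0 scal_half_double.
have y1 : cnorm y <= 1.
  have -> : cnorm y = cnorm (scal 'i * y) by rewrite cnormZ modulus_i mul1r.
  rewrite yE cnormZ modulus_half.
  have := cnormD u (- star u); rewrite cnormN cnorm_star.
  by move: u1; lra.
rewrite -y2 -{1}ys cnorm_starM.
by rewrite expr_le1 // cnorm_ge0.
Qed.

End CStarNorm.

Section SequenceAlgebraNorm.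
Variables (R : realType) (A : cstarAlgType R).
Implicit Types (a b : bfun nat A) (x y : Ainfty A).

HB.instance Definition _ := GRing.isZmodMorphism.Build (bfun nat A) (Ainfty A)
  (@etaA R A) (qproj_zmod (@c0_seq R A)).
HB.instance Definition _ := GRing.isMonoidMorphism.Build (bfun nat A) (Ainfty A)
  (@etaA R A) (qproj_monoid (@c0_seq R A)).

Lemma etaA_scal (c : R[i]) : etaA (scal c : bfun nat A) = scal c.
Proof. by []. Qed.

Lemma etaA_star a : etaA (star a) = star (etaA a).
Proof. exact: qproj_star. Qed.

Lemma etaAP x : exists a, etaA a = x.
Proof. exact: qprojP. Qed.

Lemma etaA_eqP a b :
  etaA a = etaA b <-> (fun n => cnorm (a n - b n)) @ \oo --> (0 : R).
Proof. by rewrite /etaA qproj_eq; split => [/asboolP|h]; [|apply/asboolP]. Qed.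

Lemma etaA_eq a b (u : nat -> R) : u @ \oo --> (0 : R) ->
  (forall n, cnorm (a n - b n) <= u n) -> etaA a = etaA b.
Proof.
move=> u0 abu; apply/etaA_eqP.
apply: (@squeeze_cvgr _ _ _ _ (cst 0) u) => //; last exact: cvg_cst.
by near=> n; rewrite cnorm_ge0 abu.
Unshelve. all: by end_near. Qed.

(** Replacing finitely many terms by 0 does not change the class, and leaves a representative
    bounded by [M] everywhere. *)
Lemma cnorm_etaA_le a (M : R) : 0 <= M ->
  (\forall n \near \oo, cnorm (a n) <= M) -> cnorm (etaA a) <= M.
Proof.
move=> M0 [N _ aM].
have tail_subproof : bounded_fct (fun n => if (n < N)%N then 0 else a n).
  have [K aK] := bfun_bound a; apply/asboolP; exists K => n.
  by case: ifP => // _; rewrite cnorm0 (le_trans (cnorm_ge0 _) (aK n)).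
have -> : etaA a = etaA (BFun tail_subproof).
  apply/etaA_eqP/cvgrPdist_lt => e e0; exists N => // n /= Nn.
  by rewrite ltnNge Nn /= subrr cnorm0 subrr normr0.
apply: (le_trans (qnorm_lb _ _)); apply: bnorm_le => //= n.
by case: ltnP => [_|/aM //]; rewrite cnorm0.
Qed.

(** The nontrivial half of the C*-identity in [Ainfty A]. For a lift [z] of [star x * x] of almost
    minimal norm, [star (a n) * a n] is eventually close to [z n], so the C*-identity of [A] bounds
    almost all terms of [a]. *)
Lemma Ainfty_cnorm_sq x : cnorm x ^+ 2 <= cnorm (star x * x).
Proof.
have [a <-] := etaAP x; set y := star _ * _.
have y0 : 0 <= cnorm y by exact: cnorm_ge0.
have yE : y = etaA (star a * a).
  by rewrite rmorphM /= etaA_star.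
apply/ler_addgt0Pr => e e0.
have e20 : 0 < e / 2 by rewrite divr_gt0.
have [z zy ze] := qnorm_adherent y e20.
have /etaA_eqP/cvgrPdist_lt/(_ _ e20)[N _ hN] : etaA (star a * a) = etaA z.
  by rewrite -yE -zy.
rewrite -[leRHS]sqr_sqrtr ?addr_ge0 ?(ltW e0) //.
rewrite lerXn2r ?nnegrE ?cnorm_ge0 ?sqrtr_ge0 //.
apply: cnorm_etaA_le; first exact: sqrtr_ge0.
exists N => // n /= /hN; rewrite sub0r normrN ger0_norm ?cnorm_ge0 // => h.
rewrite -[leLHS]ger0_norm ?cnorm_ge0 // -sqrtr_sqr ler_sqrt ?addr_ge0 ?(ltW e0) //.
rewrite -cnorm_starM -[_ * _](subrK (z n)).
apply: (le_trans (cnormD _ _)).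
have := bnorm_ub z n.
move: h ze; rewrite -[qnorm y]/(cnorm y) -[cnorm z]/(bnorm z).
rewrite -[(star a * a) n]/(star (a n) * a n).
by lra.
Qed.

Lemma etaA_selfadjoint x : star x = x ->
  exists2 c : bfun nat A, etaA c = x & forall n, star (c n) = c n.
Proof.
move=> xs; have [b bx] := etaAP x.
pose c := scal 2^-1 * (b + star b); exists c.
  by rewrite /c rmorphM rmorphD /= etaA_scal etaA_star bx xs scal_half_double.
move=> n.
rewrite [c n]/(scal 2^-1 * (b n + star (b n))) starM starD starK star_scal.
by rewrite fmorphV rmorph_nat -scalC [star _ + _]addrC.
Qed.

(** The inverse is built termwise: up to a fixed scalar, 1 + c_n^2 is 1 - k_n with the norm of k_n
    at most some r < 1 independent of n, so that Neumann series apply uniformly. *)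
Lemma Ainfty_one_plus_sq_inv x : star x = x -> exists g : Ainfty A,
  (1 + x * x) * g = 1 /\ g * (1 + x * x) = 1.
Proof.
move=> xs; have [c cE cs] := etaA_selfadjoint xs.
have [M0 cM0] := bfun_bound c; pose M := `|M0| + 1.
have M_gt0 : 0 < M by rewrite ltr_wpDl.
have cM n : cnorm (c n) <= M.
  by apply: (le_trans (cM0 n)); rewrite (le_trans (ler_norm _)) // lerDl.
pose q n : A := scal (2 * M)^-1%:C%C * c n.
have q_le n : cnorm (1 - q n * q n) <= 1.
  apply: cnorm_1Bsq; first by rewrite /q starM cs scal_real_star -scalC.
  rewrite cnormZ modulus_real ger0_norm ?invr_ge0 ?mulr_ge0 ?(ltW M_gt0) //.
  rewrite invfM -mulrA ler_piMr ?invr_ge0 // ler_pdivrMl // mulr1 //.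
(* Here C r = 4 M^2, C - C r = 1 and 4 M^2 q_n^2 = c_n^2, hence 1 + c_n^2 = C (1 - r (1 -
   q_n^2)). *)
pose C : R := 1 + 4 * M ^+ 2; pose r : R := 4 * M ^+ 2 / C.
have C_gt0 : 0 < C by rewrite ltr_wpDr // mulr_ge0 // sqr_ge0.
have r_ge0 : 0 <= r by rewrite divr_ge0 ?(ltW C_gt0) // mulr_ge0 // sqr_ge0.
have r_lt1 : r < 1 by rewrite ltr_pdivrMr // mul1r /C ltrDr.
pose k n : A := scal r%:C%C * (1 - q n * q n).
have k_le n : cnorm (k n) <= r.
  by rewrite cnormZ modulus_real ger0_norm // ler_piMr.
have cnk n : 1 + c n * c n = scal C%:C%C * (1 - k n).
  have qq : scal (4 * M ^+ 2)%:C%C * (q n * q n) = c n * c n.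
    have M1 : (4 * M ^+ 2)%:C%C * ((2 * M)^-1%:C%C * (2 * M)^-1%:C%C) = 1 :> R[i].
      rewrite -!(rmorphM (@real_complex R)) /= -(rmorph1 (@real_complex R)).
      by congr (_%:C%C); field; rewrite gt_eqF.
    by rewrite /q mulr_scal mulrA -rmorphM M1 rmorph1 mul1r.
  have Cr : scal C%:C%C * k n = scal (4 * M ^+ 2)%:C%C * (1 - q n * q n).
    rewrite /k mulrA -(rmorphM (@scal R A)); congr (scal _ * _).
    by rewrite -(rmorphM (@real_complex R)) /= /r mulrCA divff ?mulr1 // gt_eqF.
  rewrite mulrBr mulr1 Cr mulrBr mulr1 qq opprB {1}/C (rmorphD (@real_complex R)).
  rewrite rmorphD !rmorph1.
  by rewrite addrCA addrK addrC.
have kX n i : cnorm (k n ^+ i) <= r ^+ i.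
  elim: i => [|i IH]; first by rewrite !expr0 cnorm1_le.
  rewrite !exprS; apply: (le_trans (cnormM _ _)).
  by rewrite ler_pM ?cnorm_ge0.
(* a truncated Neumann series: the error [k n ^+ n] tends to [0] *)
pose g n : A := scal C^-1%:C%C * \sum_(i < n) k n ^+ i.
have g_subproof : bounded_fct g.
  apply/asboolP; exists (C^-1 * (1 - r)^-1) => n.
  rewrite cnormZ modulus_real ger0_norm ?invr_ge0 ?(ltW C_gt0) //.
  rewrite ler_wpM2l ?invr_ge0 ?(ltW C_gt0) //.
  apply: (@le_trans _ _ (\sum_(i < n) r ^+ i)).
    elim/big_ind2: _ => [|u s v t us vt|i _]; rewrite ?cnorm0 //.
    by apply: (le_trans (cnormD _ _)); rewrite lerD.
  rewrite -[leRHS]mul1r ler_pdivlMr ?subr_gt0 // mulrC -opprB mulNr -subrX1 opprB.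
  by rewrite gerBl exprn_ge0.
have cvg0 : (fun n => r ^+ n) @ \oo --> (0 : R).
  by apply: cvg_expr; rewrite ger0_norm.
exists (etaA (BFun g_subproof)); rewrite -cE.
have E : 1 + etaA c * etaA c = etaA (1 + c * c).
  by rewrite rmorphD rmorphM rmorph1.
have E1 : 1 = etaA (1 : bfun nat A) by rewrite rmorph1.
have geom n : (1 - k n) * \sum_(i < n) k n ^+ i - 1 = - k n ^+ n.
  by rewrite -[1 - k n]opprB mulNr -subrX1 opprB addrAC subrr add0r.
have CV : scal C%:C%C * scal C^-1%:C%C = 1 :> A.
  by rewrite -rmorphM -(rmorphM (@real_complex R)) /= divff ?gt_eqF ?rmorph1.
have kg n : k n * \sum_(i < n) k n ^+ i = (\sum_(i < n) k n ^+ i) * k n.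
  by rewrite mulr_sumr mulr_suml; apply: eq_bigr => i _; rewrite -exprS -exprSr.
have final n : cnorm ((1 + c n * c n) * g n - 1) <= r ^+ n.
  rewrite cnk /g -mulrA [(1 - _) * (scal _ * _)]mulrA -scalC !mulrA CV mul1r geom.
  by rewrite cnormN.
rewrite E E1 -!rmorphM; split; apply: (etaA_eq cvg0) => n; first exact: final.
(* Both factors are polynomials in [k n], so the right inverse is also a left one. *)
suff gc : g n * (1 + c n * c n) = (1 + c n * c n) * g n.
  by have := final n; rewrite -gc.
rewrite cnk /g; apply: commrM; last first.
  apply: commr_sym; apply: commrM; first by rewrite /GRing.comm scalC.
  by apply: commr_sym; apply: commrB; [exact: commr1|exact/esym/kg].
by rewrite /GRing.comm -scalC.
Qed.

End SequenceAlgebraNorm.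

(** * Central symmetries from UHF absorption *)

Section MatrixPaulis.
Variables (R : realType).
Local Notation C := R[i].

Lemma mxstarE m (X : 'M[C]_m) : star X = map_mx Num.conj X^T.
Proof. by apply/matrixP => i j; rewrite !mxE. Qed.

(** By the spectral theorem [p] is unitarily diagonal; its eigenvalues are idempotent, hence 0 or 1,
    and the trace counts those equal to 1. *)
Lemma spectral_projection m (p : 'M[C]_m) : star p = p -> p * p = p ->
  exists (U : 'M[C]_m) (S : {set 'I_m}),
    [/\ star U * U = 1, U * star U = 1, \tr p = #|S|%:R
      & p = \sum_(i in S) star U * delta_mx i i * U].
Proof.
move=> ps pp.
have pn : p \is normalmx.
  by apply/normalmxP; rewrite -[map_mx _ _]mxstarE ps.
have /orthomx_spectralP := pn; have := spectral_unitarymx p.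
move: (spectralmx p) (spectral_diag p) => U l Uu; rewrite invmx_unitary // -mxstarE => pE.
have UV : U * star U = 1 by move/unitarymxP: Uu; rewrite -mxstarE.
have VU : star U * U = 1 by exact: mulmx1C.
have {}pE : p = star U * diag_mx l * U by exact: pE.
have DD : diag_mx l * diag_mx l = diag_mx l.
  have DE : diag_mx l = U * p * star U.
    by rewrite pE mulrA mulrA UV mul1r -mulrA UV mulr1.
  have pe : U * p * star U * (U * p * star U) = U * p * star U.
    by rewrite -!mulrA [star U * (U * _)]mulrA VU mul1r [p * (p * _)]mulrA pp.
  by rewrite DE pe.
have l01 i : l 0 i = 0 \/ l 0 i = 1.
  move/matrixP/(_ i i): DD; rewrite [X in X = _ -> _](_ : _ = l 0 i * l 0 i); last first.
    by rewrite -[_ * _]/(_ *m _) mulmx_diag !mxE eqxx.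
  rewrite mxE eqxx mulr1n => h.
  have /eqP : l 0 i * (l 0 i - 1) = 0 by rewrite mulrBr mulr1 h subrr.
  by rewrite mulf_eq0 subr_eq0 => /orP[/eqP|/eqP]; [left|right].
have trp : \tr p = #|[set i | l 0 i == 1]%SET|%:R.
  have -> : \tr p = \tr (diag_mx l).
    rewrite pE -[_ * U]/(_ *m U) mxtrace_mulC; congr (\tr _).
    by rewrite -[U *m _]/(U * _) !mulrA UV mul1r.
  rewrite mxtrace_diag (bigID (fun i => l 0 i == 1)) /=.
  rewrite [X in _ + X]big1 ?addr0; last first.
    by move=> i; case: (l01 i) => -> //; rewrite eqxx.
  rewrite (eq_bigr (fun=> 1)) => [|i /eqP //].
  by rewrite sumr_const; congr _%:R; apply: eq_card => i; rewrite !inE.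
exists U, [set i | l 0 i == 1]%SET; split; [exact: VU|exact: UV|exact: trp|].
rewrite pE diag_mx_sum_delta mulr_sumr mulr_suml [RHS]big_mkcond.
apply: eq_bigr => i _; rewrite inE; case: (l01 i) => ->.
  by rewrite scale0r mulr0 mul0r eq_sym oner_eq0.
by rewrite eqxx scale1r.
Qed.

(** Trace 2 leaves two eigenvectors, so the corner of [p] is a copy of the 2 x 2 matrices with
    matrix units [E]; in it [s] is the diagonal Pauli matrix and [t] the flip. *)
Lemma pauli_in_corner m (p : 'M[C]_m) : star p = p -> p * p = p -> \tr p = 2 ->
  exists s t : 'M[C]_m, [/\ star s = s /\ star t = t, s * s = p /\ t * t = p,
    s * t = - (t * s), p * s = s & p * t = t].
Proof.
move=> ps pp; have [U [S [VU UV -> pE]]] := spectral_projection ps pp.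
move=> /eqP; rewrite eqr_nat => /cards2P[i [j [ij SE]]].
pose E a b : 'M[C]_m := star U * delta_mx a b * U.
have EE a b c d : E a b * E c d = E a d *+ (b == c).
  rewrite /E -!mulrA [U * (star U * _)]mulrA UV mul1r.
  rewrite [delta_mx a b * (_ * U)]mulrA -[delta_mx a b * _]/(_ *m _).
  by rewrite mul_delta_mx_cond; case: eqP => _; rewrite ?mulr1n // !mulr0n mul0r mulr0.
have Es a b : star (E a b) = E b a.
  rewrite /E !starM starK mulrA; congr (_ * _ * _).
  apply/matrixP => c d; rewrite !mxE -[star _]/(Num.conj _) rmorph_nat.
  by rewrite andbC.
have ji : j != i by rewrite eq_sym.
have pE2 : p = E i i + E j j.
  by rewrite pE SE big_setU1 ?big_set1 // inE.
clearbody E; exists (E i i - E j j), (E i j + E j i).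
rewrite starB starD !Es pE2 !(mulrDr, mulrDl, mulrN, mulNr).
rewrite !(EE, eqxx, negPf ij, negPf ji, mulr1n, mulr0n) !(addr0, add0r, oppr0, opprK).
by rewrite ?(opprD, opprK); split=> //; first [split|idtac]; rewrite // addrC.
Qed.

(** The diagonal units of [F] have equal traces adding up to [2 * k], so each corner has size 2. The
    commutant of a unital system of matrix units is isomorphic to such a corner, where a Pauli pair
    is available. *)
Lemma pauli_commutant k m (F : 'I_k -> 'I_k -> 'M[C]_m) : m = (2 * k)%N ->
    (forall a b c d, F a b * F c d = F a d *+ (b == c)) ->
    (forall a b, star (F a b) = F b a) -> \sum_a F a a = 1 -> (0 < k)%N ->
  exists s t : 'M[C]_m, pauli_pair s t /\
    forall a b, F a b * s = s * F a b /\ F a b * t = t * F a b.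
Proof.
move=> mE FF Fs F1 k0; pose o := Ordinal k0.
have tr a : \tr (F a a) = \tr (F o o).
  have -> : F a a = F a o *m F o a by rewrite -[RHS]/(_ * _) FF eqxx mulr1n.
  by rewrite mxtrace_mulC -[_ *m _]/(_ * _) FF eqxx mulr1n.
have tr2 : \tr (F o o) = 2.
  have : \tr (\sum_a F a a) = (2 * k)%:R by rewrite F1 -idmxE mxtrace1 mE.
  rewrite raddf_sum (eq_bigr (fun=> \tr (F o o))) => [|a _]; last exact: tr.
  rewrite sumr_const card_ord -[LHS]mulr_natr natrM => /mulIf; apply.
  by rewrite pnatr_eq0 -lt0n.
have poo : F o o * F o o = F o o by rewrite FF eqxx mulr1n.
have [s0 [t0 [[ss ts] [s2 t2] st ps pt]]] := pauli_in_corner (Fs o o) poo tr2.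
(* [q] maps the corner of [F o o] multiplicatively into the commutant of [F]. *)
pose q X := \sum_a F a o * X * F o a.
have qM X Y : F o o * Y = Y -> q X * q Y = q (X * Y).
  move=> pY; rewrite /q mulr_suml; apply: eq_bigr => a _.
  rewrite mulr_sumr (bigD1 a) //= big1 ?addr0 => [|b ba].
    rewrite !mulrA -[_ * F o a * F a o]mulrA FF eqxx mulr1n -!mulrA.
    by rewrite [F o o * (Y * _)]mulrA pY.
  by rewrite !mulrA -[_ * F o a * F b o]mulrA FF eq_sym (negPf ba) mulr0n mulr0 !mul0r.
have qs X : star (q X) = q (star X).
  rewrite /q (big_morph _ (@starD R _) (star0 _)); apply: eq_bigr => a _.
  by rewrite !starM !Fs mulrA.
have qp : q (F o o) = 1.
  by rewrite -F1; apply: eq_bigr => a _; rewrite FF eqxx mulr1n FF eqxx.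
have qN X : q (- X) = - q X.
  by rewrite /q -sumrN; apply: eq_bigr => a _; rewrite mulrN mulNr.
have qF X a b : F a b * q X = q X * F a b.
  rewrite /q mulr_sumr mulr_suml (bigD1 b) //= big1 ?addr0; last first.
    by move=> c cb; rewrite !mulrA FF eq_sym (negPf cb) mulr0n !mul0r.
  rewrite [RHS](bigD1 a) //= big1 ?addr0; last first.
    by move=> c ca; rewrite -mulrA FF (negPf ca) mulr0n mulr0.
  by rewrite !mulrA FF eqxx -[RHS]mulrA FF eqxx.
exists (q s0), (q t0); split; last by move=> a b; rewrite !qF.
by split; rewrite ?qs ?ss ?ts ?qM // ?s2 ?t2 ?qp // st qN.
Qed.

End MatrixPaulis.

(** * Approximately central Pauli pairs in an absorbing algebra *)

Section CentralPaulis.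
Variable R : realType.

Lemma cnorm_commutator (B : normedStarAlgType R) (s x : B) :
  cnorm (s * x - x * s) <= 2 * cnorm s * cnorm x.
Proof.
apply: (le_trans (cnormD _ _)); rewrite cnormN.
have := cnormM s x; have := cnormM x s; rewrite [cnorm x * _]mulrC.
by lra.
Qed.

Lemma cnorm_pauli (B : cstarAlgType R) (s t : B) : pauli_pair s t ->
  cnorm s <= 1 /\ cnorm t <= 1.
Proof. by move=> [ss ts s2 t2 _]; split; apply: cnorm_unitary; rewrite ?ss ?ts. Qed.

Lemma starhom_pauli (B T : starAlgType R) (f : {rmorphism B -> T}) (s t : B) :
  starhom f -> pauli_pair s t -> pauli_pair (f s) (f t).
Proof.
move=> [_ fs] [ss ts s2 t2 st]; split.
- by rewrite -fs ss.
- by rewrite -fs ts.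
- by rewrite -rmorphM s2 rmorph1.
- by rewrite -rmorphM t2 rmorph1.
- by rewrite -!rmorphM st rmorphN.
Qed.

Section Tower.
Variables (B : cstarAlgType R).
Variable theta : forall n : nat, {rmorphism 'M[R[i]]_(2 ^ n) -> B}.
Hypotheses (theta_hom : forall n, starhom (theta n))
  (theta_inj : forall n, injective (theta n))
  (theta_sub : forall n, range (theta n) `<=` range (theta n.+1)).

Lemma theta_scale n (c : R[i]) X : theta n (c *: X) = scal c * theta n X.
Proof.
rewrite -(theta_hom n).1 -rmorphM; congr (theta n _).
by rewrite -[RHS]/(_ *m _) mul_scalar_mx.
Qed.

Lemma theta_le n m : (n <= m)%N -> range (theta n) `<=` range (theta m).
Proof.
move=> /subnK <-; elim: (m - n)%N => [|d IH] //; rewrite addSn.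
by move=> x /IH; exact: theta_sub.
Qed.

(** The next stage is twice as large, which leaves room for a Pauli pair in the commutant of stage
    [n]. The matrix units of stage [n] are pulled back along [theta n.+1], whose injectivity
    transfers their relations. *)
Lemma theta_pauli n : exists s t : B, pauli_pair s t /\
  forall X, GRing.comm s (theta n X) /\ GRing.comm t (theta n X).
Proof.
have lift a b : exists X, theta n.+1 X = theta n (delta_mx a b).
  have /theta_sub[X _ Xab] : range (theta n) (theta n (delta_mx a b)).
    by exists (delta_mx a b).
  by exists X.
pose F a b := sval (cid (lift a b)).
have FE a b : theta n.+1 (F a b) = theta n (delta_mx a b).
  exact: svalP (cid (lift a b)).
have [|a b c d|a b|||s [t [st Fst]]] := @pauli_commutant R _ _ F.
- by rewrite expnS.
- apply: theta_inj; rewrite rmorphM rmorphMn !FE -rmorphM -rmorphMn.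
  by congr (theta n _); exact: mul_delta_mx_cond.
- apply: theta_inj; rewrite (theta_hom _).2 !FE -(theta_hom _).2.
  congr (theta n _); apply/matrixP => i j.
  by rewrite !mxE -[star _]/(Num.conj _) rmorph_nat andbC.
- apply: theta_inj; rewrite rmorph1 rmorph_sum -(rmorph1 (theta n)).
  rewrite -[1 in RHS]/(1%:M) mx1_sum_delta rmorph_sum.
  by apply: eq_bigr => a _; exact: FE.
- by rewrite expn_gt0.
exists (theta n.+1 s), (theta n.+1 t); split.
  exact: starhom_pauli (theta_hom _) st.
have comm u : (forall a b, F a b * u = u * F a b) ->
    forall X, GRing.comm (theta n.+1 u) (theta n X).
  move=> Fu X; rewrite [X]matrix_sum_delta rmorph_sum; apply: commr_sum => a _.
  rewrite rmorph_sum; apply: commr_sum => b _; rewrite theta_scale -FE.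
  apply: commrM; first by rewrite /GRing.comm scalC.
  by rewrite /GRing.comm -!rmorphM Fu.
by move=> X; split; apply: comm => a b; have [] := Fst a b.
Qed.

Hypothesis theta_dense : forall b, adherent (\bigcup_n range (theta n)) b.
Variables (T : cstarAlgType R) (j : {rmorphism B -> T}).
Hypothesis j_hom : starhom j.

(** Asymptotic commutation with the relative commutants of the stages, uniform over their unit balls
    so that a stage can be fixed before a Pauli pair is chosen. *)
Definition tail_commuting (y : T) := forall e : R, 0 < e -> exists N : nat,
  forall n, (N <= n)%N -> forall s : B, cnorm s <= 1 ->
    (forall X, GRing.comm s (theta n X)) -> cnorm (j s * y - y * j s) < e.

Lemma tail_commutingD y z :
  tail_commuting y -> tail_commuting z -> tail_commuting (y + z).
Proof.
move=> yt zt e e0; have e20 : 0 < e / 2 by rewrite divr_gt0.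
have [N yN] := yt _ e20; have [M zM] := zt _ e20.
exists (maxn N M) => n; rewrite geq_max => /andP[Nn Mn] s s1 sc.
rewrite mulrDr mulrDl opprD addrACA; apply: (le_lt_trans (cnormD _ _)).
by rewrite [e]splitr ltrD //; [exact: (yN n)|exact: (zM n)].
Qed.

Lemma tail_commuting_tensor (a : T) b :
  (forall c, a * j c = j c * a) -> tail_commuting (a * j b).
Proof.
(* Only the part of [b] off the stage contributes to the commutator: 2 comes from the commutator, 4
   from the bound on [j], and the summand 1 keeps [K] positive. *)
move=> ac e e0; pose K := 8 * cnorm a + 1.
have K0 : 0 < K by rewrite ltr_wpDl // mulr_ge0 ?cnorm_ge0.
have [_ [N _ [X _ <-]] bX] := theta_dense b (divr_gt0 e0 K0).
exists N => n Nn s s1 sc.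
have [X' _ X'X] := theta_le Nn (ex_intro2 _ _ X I erefl : range _ (theta N X)).
have -> : j s * (a * j b) - a * j b * j s =
    a * j (s * (b - theta N X) - (b - theta N X) * s).
  have -> : s * (b - theta N X) - (b - theta N X) * s = s * b - b * s.
    by rewrite mulrBr mulrBl -X'X sc opprB addrA subrK.
  by rewrite rmorphB !rmorphM mulrBr !mulrA -(ac s).
apply: (le_lt_trans (cnormM _ _)).
have := starhom_bounded j_hom (s * (b - theta N X) - (b - theta N X) * s).
have := cnorm_commutator s (b - theta N X).
have : cnorm s * cnorm (b - theta N X) <= cnorm (b - theta N X).
  by rewrite ler_piMl ?cnorm_ge0.
move: bX; rewrite ltr_pdivlMr // /K.
have := cnorm_ge0 a; have := cnorm_ge0 (b - theta N X).
set u := cnorm (b - _); set v := cnorm a; set w := cnorm (j _) => u0 v0 h1 h2 h3 h4.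
have w8 : w <= 8 * u by lra.
by have := ler_wpM2l v0 w8; lra.
Qed.

Lemma tail_commuting_adherent y : adherent tail_commuting y -> tail_commuting y.
Proof.
(* As [j s] has norm at most 4, replacing [y] by [z] costs at most 8 times their distance, which is
   less than e / 2. *)
move=> yt e e0; have [z zt yz] := yt (e / 16) (divr_gt0 e0 (ltr0n _ 16)).
have [N zN] := zt _ (divr_gt0 e0 (ltr0n R 2)).
exists N => n Nn s s1 sc.
rewrite -[y](subrK z) mulrDr mulrDl opprD addrACA.
apply: (le_lt_trans (cnormD _ _)).
have := zN _ Nn _ s1 sc; have := cnorm_commutator (j s) (y - z).
have js : cnorm (j s) <= 4 by have := starhom_bounded j_hom s; lra.
have := ler_wpM2r (cnorm_ge0 (y - z)) js; lra.
Qed.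

End Tower.

(** Sums of elementary tensors are tail commuting and dense in the tensor product, so all its
    elements are. A Pauli pair commuting with a late stage then almost commutes with the image of
    [F], and is carried back by the inverse isomorphism. *)
Lemma central_pauli (A : cstarAlgType R) : absorbs_UHF_2infty A ->
  forall (F : seq A) (e : R), 0 < e -> exists st : A * A,
    pauli_pair st.1 st.2 /\ forall x, x \in F ->
      cnorm (st.1 * x - x * st.1) < e /\ cnorm (st.2 * x - x * st.2) < e.
Proof.
move=> [B [[theta [th_hom th_inj th_sub th_dense]] [T [[i [j [[ih jh] ij _ T_dense]]]]]]].
move=> [f [fh [g fK gK]]] F e e0.
have g_zmod : zmod_morphism g.
  by move=> x y; apply: (can_inj fK); rewrite rmorphB !gK.
have g_monoid : monoid_morphism g.
  split; first by apply: (can_inj fK); rewrite gK rmorph1.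
  by move=> x y; apply: (can_inj fK); rewrite rmorphM !gK.
pose G : {rmorphism T -> A} := HB.pack g
  (GRing.isZmodMorphism.Build T A g g_zmod)
  (GRing.isMonoidMorphism.Build T A g g_monoid).
have Gh : starhom G.
  split; first by move=> c; apply: (can_inj fK); rewrite gK fh.1.
  by move=> x; apply: (can_inj fK); rewrite fh.2 !gK.
have tailT y : tail_commuting theta j y.
  apply: tail_commuting_adherent => // d d0.
  have [_ [n [a [b ->]]] yd] := T_dense y _ d0.
  exists (\sum_k i (a k) * j (b k)) => //.
  elim/big_ind: _ => [d' d'0|u v|k _].
  - by exists 0%N => *; rewrite mulr0 mul0r subrr cnorm0.
  - exact: tail_commutingD.
  - by apply: tail_commuting_tensor => // c; exact: ij.
(* The margin e / 4 absorbs the factor 4 in the bound on [G]. *)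
have [N FN] : exists N : nat, forall x, x \in F -> forall s : B, cnorm s <= 1 ->
    (forall X, GRing.comm s (theta N X)) -> cnorm (j s * f x - f x * j s) < e / 4.
  have e40 : 0 < e / 4 by rewrite divr_gt0.
  have [N FN] : exists N : nat, forall n, (N <= n)%N -> forall x, x \in F ->
      forall s : B, cnorm s <= 1 -> (forall X, GRing.comm s (theta n X)) ->
      cnorm (j s * f x - f x * j s) < e / 4.
    elim: F => [|x F [N FN]]; first by exists 0%N.
    have [M xM] := tailT (f x) _ e40.
    exists (maxn N M) => n; rewrite geq_max => /andP[Nn Mn] z.
    by rewrite inE => /orP[/eqP ->|/FN]; [exact: xM|exact].
  by exists N; exact: FN.
have [s [t [st stc]]] := theta_pauli th_hom th_inj th_sub N.
have [s1 t1] := cnorm_pauli st.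
have bound u : cnorm u <= 1 -> (forall X, GRing.comm u (theta N X)) ->
    forall x, x \in F -> cnorm (G (j u) * x - x * G (j u)) < e.
  move=> u1 uc x xF; have := FN _ xF _ u1 uc.
  rewrite -[x in X in _ -> X]fK -!(rmorphM G) -(rmorphB G).
  have := starhom_bounded Gh (j u * f x - f x * j u).
  by lra.
exists (G (j s), G (j t)); split.
  by apply: (starhom_pauli Gh); exact: starhom_pauli jh st.
by move=> x xF; split; apply: bound => // X; have [] := stc X.
Qed.

End CentralPaulis.

(** * The odd selfadjoint element attached to two commuting towers *)

Section OddSymmetry.
Variables (R : realType) (Q : starAlgType R) (f : {rmorphism Q -> Q}).
Hypotheses (f_starhom : starhom f) (fK : involutive f).
Implicit Types z : Q.

Lemma comm_rmorph (u v : Q) : GRing.comm u (f v) -> GRing.comm (f u) v.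
Proof. by move=> uv; rewrite /GRing.comm -[v]fK -!rmorphM uv. Qed.

(** [weighted_pauli] applied to each tower gives the input of [twisted_product]. The last clause
    holds because [S] is a polynomial in the listed elements; it serves to show later that [S] is
    central and commutes with the towers. *)
Lemma odd_symmetry_square (e0 e1 k0 k1 s t s' t' : Q) :
    odd_tower f e0 e1 -> odd_tower f k0 k1 ->
    (forall e k, e \in [:: e0; e1] -> k \in [:: k0; k1] -> GRing.comm e k) ->
    pauli_pair s t -> pauli_pair s' t' ->
    (forall p e, p \in [:: s; t] -> e \in [:: e0; e1; k0; k1] -> GRing.comm p e) ->
    (forall p e, p \in [:: s'; t'] ->
       e \in [:: e0; e1; k0; k1; s; t; f s; f t] -> GRing.comm p e) ->
  exists S : Q,
    [/\ star S = S, f S = - S,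
      S * S = ((e0 + e1) * (e0 + e1) + (k0 + k1) * (k0 + k1)) *
              ((e0 + e1) * (e0 + e1) + (k0 + k1) * (k0 + k1))
      & forall z, (forall u, u \in [:: e0; e1; k0; k1; s; t; f s; f t; s'; t'; f s'; f t'] ->
          GRing.comm z u) -> GRing.comm z S].
Proof.
move=> et kt ek st st' ce ck.
have fe0 := tower_swap et; have fk0 := tower_swap kt.
have fe1 : f e1 = e0 by rewrite -fe0 fK.
have fk1 : f k1 = k0 by rewrite -fk0 fK.
have memE e : e \in [:: e0; e1; k0; k1] -> f e \in [:: e0; e1; k0; k1].
  by rewrite !inE => /or4P[]/eqP->; rewrite ?fe0 ?fe1 ?fk0 ?fk1 eqxx ?orbT.
have memS p : p \in [:: s; t; f s; f t] -> f p \in [:: s; t; f s; f t].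
  by rewrite !inE => /or4P[]/eqP->; rewrite ?fK eqxx ?orbT.
have cE p e : p \in [:: s; t; f s; f t; s'; t'; f s'; f t'] ->
    e \in [:: e0; e1; k0; k1] -> GRing.comm p e.
  have cEf q e' : (forall e, e \in [:: e0; e1; k0; k1] -> GRing.comm q e) ->
      e' \in [:: e0; e1; k0; k1] -> GRing.comm (f q) e'.
    by move=> qe /memE /qe; exact: comm_rmorph.
  have ce' q e' : q \in [:: s'; t'] -> e' \in [:: e0; e1; k0; k1] -> GRing.comm q e'.
    move=> qs es; apply: ck => //.
    by move: es; rewrite !inE => /or4P[]/eqP->; rewrite eqxx ?orbT.
  move=> pm em; move: pm; rewrite !inE => /orP[/eqP->|/orP[/eqP->|/orP[/eqP->|
    /orP[/eqP->|/orP[/eqP->|/orP[/eqP->|/orP[/eqP->|/eqP->]]]]]]].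
  - by apply: ce; rewrite // !inE eqxx.
  - by apply: ce; rewrite // !inE eqxx orbT.
  - by apply: cEf => // e' e'm; apply: ce; rewrite // !inE eqxx.
  - by apply: cEf => // e' e'm; apply: ce; rewrite // !inE eqxx orbT.
  - by apply: ce'; rewrite // !inE eqxx.
  - by apply: ce'; rewrite // !inE eqxx orbT.
  - by apply: cEf => // e' e'm; apply: ce'; rewrite // !inE eqxx.
  - by apply: cEf => // e' e'm; apply: ce'; rewrite // !inE eqxx orbT.
have cS p q : p \in [:: s'; t'; f s'; f t'] -> q \in [:: s; t; f s; f t] ->
    GRing.comm p q.
  have cs q' p' : q' \in [:: s; t; f s; f t] -> p' \in [:: s'; t'] -> GRing.comm p' q'.
    move=> q'm p'm; apply: ck => //.
    by move: q'm; rewrite !inE => /or4P[]/eqP->; rewrite eqxx ?orbT.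
  move=> pm qm; move: pm; rewrite !inE => /or4P[]/eqP->.
  - by apply: cs; rewrite // !inE eqxx.
  - by apply: cs; rewrite // !inE eqxx orbT.
  - by apply: comm_rmorph; apply: cs; rewrite ?memS // !inE eqxx.
  - by apply: comm_rmorph; apply: cs; rewrite ?memS // !inE eqxx orbT.
have [fx xx yy xy] : _ := weighted_pauli f_starhom fK et st
  (fun z zst => commr_sym (ce z e0 zst ltac:(by rewrite !inE eqxx)))
  (fun z zst => commr_sym (ce z e1 zst ltac:(by rewrite !inE eqxx orbT))).
have sk (p : Q) e : p \in [:: s'; t'] -> e \in [:: k0; k1] -> GRing.comm e p.
  move=> pm em; apply: commr_sym; apply: ck => //.
  by move: em; rewrite !inE => /orP[]/eqP->; rewrite eqxx ?orbT.
have [fx' xx' yy' xy'] : _ := weighted_pauli f_starhom fK kt st'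
  (fun z zst => sk z k0 zst ltac:(by rewrite !inE eqxx))
  (fun z zst => sk z k1 zst ltac:(by rewrite !inE eqxx orbT)).
move: fx xx yy xy fx' xx' yy' xy'.
set x := e0 * t + _; set y := e0 * s - _; set x' := k0 * t' + _; set y' := k0 * s' - _.
move=> fx xx yy xy fx' xx' yy' xy'.
have wc (a b c0 c1 z : Q) : (forall u, u \in [:: c0; c1; a; b; f a; f b] -> GRing.comm z u) ->
    GRing.comm z (c0 * b + c1 * f b) /\ GRing.comm z (c0 * a - c1 * f a).
  move=> zu; split.
    by apply: commrD; apply: commrM; apply: zu; rewrite !inE eqxx ?orbT.
  by apply: commrB; apply: commrM; apply: zu; rewrite !inE eqxx ?orbT.
have W z : (forall u, u \in [:: e0; e1; s; t; f s; f t] -> GRing.comm z u) ->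
    GRing.comm z x /\ GRing.comm z y by exact: wc.
have W' z : (forall u, u \in [:: k0; k1; s'; t'; f s'; f t'] -> GRing.comm z u) ->
    GRing.comm z x' /\ GRing.comm z y' by exact: wc.
(* Every ingredient of [x], [y] commutes with every ingredient of [x'], [y']; this yields the four
   cross commutations of [twisted_product]. *)
have cross u v : u \in [:: e0; e1; s; t; f s; f t] ->
    v \in [:: k0; k1; s'; t'; f s'; f t'] -> GRing.comm u v.
  have split6 (w a b c d g h : Q) : w \in [:: a; b; c; d; g; h] ->
      w \in [:: a; b] \/ w \in [:: c; d; g; h].
    by rewrite !inE orbA => /orP[]; [left|right].
  have subE w : w \in [:: e0; e1] \/ w \in [:: k0; k1] -> w \in [:: e0; e1; k0; k1].
    by rewrite !inE => -[]/orP[]/eqP->; rewrite eqxx ?orbT.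
  have subS w : w \in [:: s; t; f s; f t] \/ w \in [:: s'; t'; f s'; f t'] ->
      w \in [:: s; t; f s; f t; s'; t'; f s'; f t'].
    by rewrite !inE => -[]/or4P[]/eqP->; rewrite eqxx ?orbT.
  move=> /split6[um|um] /split6[vm|vm].
  - exact: ek.
  - by apply: commr_sym; apply: cE; [apply: subS; right|apply: subE; left].
  - by apply: cE; [apply: subS; left|apply: subE; right].
  - by apply: commr_sym; exact: cS.
have [cx' cy'] : (forall u, u \in [:: e0; e1; s; t; f s; f t] -> GRing.comm x' u) /\
    (forall u, u \in [:: e0; e1; s; t; f s; f t] -> GRing.comm y' u).
  by split=> u um; apply: commr_sym; have [] := W' u (fun v => cross u v um).
have [x'x x'y] := W _ cx'; have [y'x y'y] := W _ cy'.
have [sS fS SS] := twisted_product f_starhom fx fx' xx yy xy xx' yy' xy'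
  (esym x'x) (esym y'x) (esym x'y) (esym y'y).
eexists; split; [exact: sS|exact: fS|exact: SS|].
move=> z zu.
have [zx zy] : GRing.comm z x /\ GRing.comm z y.
  by apply: W => u; rewrite !inE => um; apply: zu; rewrite !inE;
     move: um => /orP[/eqP->|/orP[/eqP->|/or4P[]/eqP->]]; rewrite eqxx ?orbT.
have [zx' zy'] : GRing.comm z x' /\ GRing.comm z y'.
  by apply: W' => u; rewrite !inE => um; apply: zu; rewrite !inE;
     move: um => /orP[/eqP->|/orP[/eqP->|/or4P[]/eqP->]]; rewrite eqxx ?orbT.
have zi : GRing.comm z (scal 'i) by rewrite /GRing.comm scalC.
by apply: commrM; apply: commrD => //; exact: commrM.
Qed.

End OddSymmetry.

(** * Central Pauli pairs in the sequence algebra *)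

Section DiagonalPaulis.
Variables (R : realType) (A : cstarAlgType R).

Lemma separable_dense_sequence : separable A ->
  exists d : nat -> A, forall (x : A) e, 0 < e -> exists n, cnorm (x - d n) < e.
Proof.
move=> [S [/countable_injP[f f_inj] S_dense]].
(* A left inverse of the enumeration, with default value 0 at the integers that are not attained. *)
have pre n : exists x : A, forall y, S y -> f y = n -> y = x.
  have [[y [Sy fy]]|no] := pselect (exists y, S y /\ f y = n); last first.
    by exists 0 => y Sy fy; case: no; exists y.
  by exists y => z Sz fz; apply: f_inj; rewrite ?inE // fz fy.
exists (fun n => sval (cid (pre n))) => x e e0.
have [y Sy xy] := S_dense x _ e0; exists (f y).
by rewrite -(svalP (cid (pre (f y))) y).
Qed.

(** Diagonal argument: the pair number n commutes up to 1 / (n + 1) with the first n + 1 terms of a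
    dense sequence and with the n-th terms of lifts of [xs]. In the limit it commutes with [A] and
    with [xs]. *)
Lemma diagonal_pauli (xs : seq (Ainfty A)) : separable A -> absorbs_UHF_2infty A ->
  exists s t : Ainfty A, pauli_pair s t /\ forall p, p \in [:: s; t] ->
    (forall a, GRing.comm p (Ainfty_cst a)) /\
    (forall x, x \in xs -> GRing.comm p x).
Proof.
move=> /separable_dense_sequence[d d_dense] absA.
pose F n := [seq d i | i <- iota 0 n.+1] ++ [seq (qrepr x : bfun nat A) n | x <- xs].
have stP n := central_pauli absA (F n) (e := n.+1%:R^-1).
have {}stP n : exists st : A * A, pauli_pair st.1 st.2 /\ forall x, x \in F n ->
    cnorm (st.1 * x - x * st.1) < n.+1%:R^-1 /\
    cnorm (st.2 * x - x * st.2) < n.+1%:R^-1.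
  by apply: stP; rewrite invr_gt0.
pose st n := sval (cid (stP n)).
have st_pauli n : pauli_pair (st n).1 (st n).2 by have [] := svalP (cid (stP n)).
have st_comm n x : x \in F n ->
    cnorm ((st n).1 * x - x * (st n).1) < n.+1%:R^-1 /\
    cnorm ((st n).2 * x - x * (st n).2) < n.+1%:R^-1.
  by have [_] := svalP (cid (stP n)); apply.
have s_bd : bounded_fct (fun n => (st n).1).
  by apply/asboolP; exists 1 => n; have [] := cnorm_pauli (st_pauli n).
have t_bd : bounded_fct (fun n => (st n).2).
  by apply/asboolP; exists 1 => n; have [] := cnorm_pauli (st_pauli n).
have harm : (fun n => n.+1%:R^-1 : R) @ \oo --> (0 : R) by exact: cvg_harmonic.
have central (p : bfun nat A) : (forall n, cnorm (p n) <= 1) ->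
    (forall n x, x \in F n -> cnorm (p n * x - x * p n) < n.+1%:R^-1) ->
    (forall a, GRing.comm (etaA p) (Ainfty_cst a)) /\
    (forall x, x \in xs -> GRing.comm (etaA p) x).
  move=> p1 pF; split => [a|x xxs]; last first.
    rewrite /GRing.comm -[x](qreprK (I := @c0_seq R A)) -[qproj _ _]/(etaA (qrepr x)).
    rewrite -!rmorphM; apply: (etaA_eq harm) => n; apply: ltW; apply: pF.
    by rewrite mem_cat; apply/orP; right; apply/mapP; exists x.
  rewrite /GRing.comm /Ainfty_cst -!rmorphM; apply/etaA_eqP/cvgrPdist_lt => e e0.
  have [i di] := d_dense a (e / 4) (divr_gt0 e0 (ltr0n _ 4)).
  have /cvgrPdist_lt/(_ _ (divr_gt0 e0 (ltr0n R 4)))[N _ hN] := harm.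
  exists (maxn i N) => // n /=; rewrite geq_max => /andP[i_n Nn].
  rewrite sub0r normrN ger0_norm ?cnorm_ge0 // -[X in cnorm X]/(p n * a - a * p n).
  have := hN _ Nn; rewrite sub0r normrN ger0_norm ?invr_ge0 // => n_e.
  have : d i \in F n by rewrite mem_cat map_f // mem_iota.
  move=> /pF; rewrite -{1 2}[a](subrK (d i)) mulrDr mulrDl opprD addrACA => h.
  apply: (le_lt_trans (cnormD _ _)).
  have le2 : cnorm (p n * (a - d i) - (a - d i) * p n) <= 2 * cnorm (a - d i).
    apply: (le_trans (cnorm_commutator _ _)); rewrite -mulrA ler_pM2l //.
    by rewrite ler_piMl ?cnorm_ge0.
  have arith (u v w r : R) : 0 < r -> u <= 2 * v -> v < r / 4 -> w < r / 4 -> u + w < r.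
    by lra.
  exact: arith e0 le2 di (lt_trans h n_e).
have [s_pos t_pos] : (forall n, cnorm (st n).1 <= 1) /\ (forall n, cnorm (st n).2 <= 1).
  by split=> n; have [] := cnorm_pauli (st_pauli n).
exists (etaA (BFun s_bd)), (etaA (BFun t_bd)); split.
  split; rewrite -?etaA_star -?rmorphM -?rmorphN -?(rmorph1 (@etaA R A));
    by congr etaA; apply: bfun_ext => n; case: (st_pauli n).
move=> p; rewrite !inE => /orP[/eqP->|/eqP->]; apply: central => // n x xF.
  by have [] := st_comm n x xF.
by have [] := st_comm n x xF.
Qed.

End DiagonalPaulis.

(** * The central sequence algebra F(A, A) *)

Section KappaMorphism.
Variables (R : realType) (A : cstarAlgType R) (D : csubalgebra A).

HB.instance Definition _ := GRing.isZmodMorphism.Build (commutant D) (Fcentral D)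
  (@kappa R A D) (qproj_zmod (@annihilator R A D)).
HB.instance Definition _ := GRing.isMonoidMorphism.Build (commutant D) (Fcentral D)
  (@kappa R A D) (qproj_monoid (@annihilator R A D)).

Lemma kappa_star (x : commutant D) : kappa (star x) = star (kappa x).
Proof. exact: qproj_star. Qed.

Lemma kappaP (z : Fcentral D) : exists x, kappa x = z.
Proof. exact: qprojP. Qed.

End KappaMorphism.

Section FullSubalgebra.
Variables (R : realType) (A : cstarAlgType R).

(** The towers are used for D = A: the unit makes it sigma-unital and trivializes the
    annihilator. *)
Definition full_csubalgebra : csubalgebra A :=
  @CSubalgebra R A setT I (fun _ _ _ _ => I) (fun _ _ _ => I) (fun _ _ _ _ => I)
    (fun _ _ => I) (fun _ _ => I).

Local Notation FA := (Fcentral full_csubalgebra).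

Lemma full_sigma_unital : sigma_unital full_csubalgebra.
Proof.
exists (fun=> 1); split=> [n|n|d _].
- split=> //; last exact: cnorm1_le.
  by exists 1; rewrite star1 mulr1.
- by exists 0; rewrite subrr mulr0.
- by split; apply: cvg_near_cst; near=> n; rewrite ?mul1r ?mulr1 subrr cnorm0.
Unshelve. all: by end_near. Qed.

Lemma kappa_full_inj : injective (@kappa R A full_csubalgebra).
Proof.
move=> x y /qproj_eq/asboolP/(_ 1 I)[+ _].
have -> : Ainfty_cst 1 = 1 :> Ainfty A.
  by rewrite -(rmorph1 (@etaA R A)); congr etaA; apply: bfun_ext.
rewrite mulr1 => /eqP.
by rewrite -[val (x - y)]/(val x - val y) subr_eq0 => /eqP /val_inj.
Qed.

(** As [kappa] is injective here, this identifies F(A, A) with the relative commutant of [A] in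
    [Ainfty A]. *)
Definition unkappa (z : FA) : Ainfty A := val (qrepr z).

Lemma unkappa_kappa (x : commutant full_csubalgebra) : unkappa (kappa x) = val x.
Proof. by congr val; apply: kappa_full_inj; exact: qreprK. Qed.

Lemma unkappaD z w : unkappa (z + w) = unkappa z + unkappa w.
Proof.
have [x <-] := kappaP z; have [y <-] := kappaP w.
by rewrite -rmorphD /= !unkappa_kappa.
Qed.

Lemma unkappaM z w : unkappa (z * w) = unkappa z * unkappa w.
Proof.
have [x <-] := kappaP z; have [y <-] := kappaP w.
by rewrite -rmorphM /= !unkappa_kappa.
Qed.

Lemma unkappa0 : unkappa 0 = 0.
Proof. by apply: (addrI (unkappa 0)); rewrite -unkappaD !addr0. Qed.

Lemma unkappa1 : unkappa 1 = 1.
Proof. by rewrite -[1 in LHS]/(kappa 1) unkappa_kappa. Qed.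

Lemma unkappa_star z : unkappa (star z) = star (unkappa z).
Proof.
have [x <-] := kappaP z.
by rewrite -kappa_star !unkappa_kappa.
Qed.

Lemma unkappa_comm z a : GRing.comm (unkappa z) (Ainfty_cst a).
Proof. exact: commutant_comm. Qed.

End FullSubalgebra.

Section OrderZeroTower.
Variables (R : realType) (gT : finGroupType).

Lemma bdelta_subproof (g : gT) : bounded_fct (fun h => (h == g)%:R : R[i]).
Proof.
apply/asboolP; exists (1 + cnorm (0 : R[i])) => h.
by case: eqP => _; rewrite ?cnorm0 ?addr0 //; rewrite -[cnorm _]/(modulus 1) modulus1.
Qed.

Definition bdelta g : CG R gT := BFun (bdelta_subproof g).

Lemma left_translation_bdelta g h : left_translation g (bdelta h) = bdelta (g * h)%g.
Proof. by apply: bfun_ext => t /=; rewrite -(inj_eq (mulgI g)) mulKVg. Qed.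

Lemma bdelta_star g : star (bdelta g) = bdelta g.
Proof. by apply: bfun_ext => t; rewrite -[LHS]/(Num.conj _) /= rmorph_nat. Qed.

Lemma bdeltaM g h : bdelta g * bdelta h = if g == h then bdelta g else 0.
Proof.
apply: bfun_ext => t; rewrite -[LHS]/((t == g)%:R * (t == h)%:R) -natrM mulnb.
case: (eqVneq g h) => [->|gh]; first by rewrite andbb.
by case: (eqVneq t g) => [->|] //=; rewrite (negPf gh).
Qed.

Lemma positive_bdelta g : positive (bdelta g).
Proof. by exists (bdelta g); rewrite bdelta_star bdeltaM eqxx. Qed.

(** Matrices of size 1 turn complete positivity into positivity, and positive elements are
    selfadjoint. *)
Lemma completely_positive_star (B F : normedStarAlgType R) (phi : B -> F) x :
  completely_positive phi -> positive x -> star (phi x) = phi x.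
Proof.
move=> cp [y xy].
have /cp[Y] : positive (\matrix_(i, j) x : 'M[B]_1).
  exists (\matrix_(i, j) y); apply/matrixP => i j.
  by rewrite !mxE big_ord1 !mxE.
move/matrixP/(_ 0 0); rewrite !mxE big_ord1 !mxE => ->.
by rewrite starM starK.
Qed.

End OrderZeroTower.

(** * The odd symmetry *)

Section AinftyAction.
Variables (R : realType) (gT : finGroupType) (A : cstarAlgType R).
Variable alpha : cstar_action gT A.

Lemma Ainfty_act_star g (x : Ainfty A) :
  Ainfty_act alpha g (star x) = star (Ainfty_act alpha g x).
Proof.
have [a <-] := etaAP x; rewrite -etaA_star !Ainfty_act_eta -etaA_star.
by congr etaA; apply: bfun_ext => n; exact: (act_starhom alpha g).2.
Qed.

Lemma Ainfty_act_scal g (c : R[i]) : Ainfty_act alpha g (scal c) = scal c.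
Proof.
rewrite -etaA_scal Ainfty_act_eta.
by congr etaA; apply: bfun_ext => n; exact: (act_starhom alpha g).1.
Qed.

Lemma Ainfty_act_monoid g : monoid_morphism (Ainfty_act alpha g).
Proof.
split=> [|x y]; last exact: Ainfty_actM.
by rewrite -(rmorph1 (@scal R (Ainfty A))) Ainfty_act_scal.
Qed.

HB.instance Definition _ g := GRing.isZmodMorphism.Build (Ainfty A) (Ainfty A)
  (Ainfty_act alpha g) (Ainfty_actB alpha g).
HB.instance Definition _ g := GRing.isMonoidMorphism.Build (Ainfty A) (Ainfty A)
  (Ainfty_act alpha g) (Ainfty_act_monoid g).

Lemma Ainfty_act_starhom g : starhom (Ainfty_act alpha g).
Proof. by split=> [c|x]; [exact: Ainfty_act_scal|exact: Ainfty_act_star]. Qed.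

Lemma Ainfty_act_comp g h (x : Ainfty A) :
  Ainfty_act alpha g (Ainfty_act alpha h x) = Ainfty_act alpha (g * h)%g x.
Proof.
have [a <-] := etaAP x; rewrite !Ainfty_act_eta.
by congr etaA; apply: bfun_ext => n; exact: (esym (Defs.actM alpha g h (a n))).
Qed.

Lemma Ainfty_act1 (x : Ainfty A) : Ainfty_act alpha 1%g x = x.
Proof.
have [a <-] := etaAP x; rewrite Ainfty_act_eta.
by congr etaA; apply: bfun_ext => n; exact: Defs.act1.
Qed.

Lemma unkappa_act (Dinv : act_invariant alpha (full_csubalgebra A)) g z :
  unkappa (Fcentral_act Dinv g z) = Ainfty_act alpha g (unkappa z).
Proof. by have [x <-] := kappaP z; rewrite Fcentral_act_kappa !unkappa_kappa. Qed.

End AinftyAction.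

Section OddSymmetryFromTowers.
Variables (R : realType) (A : cstarAlgType R) (alpha : cstar_action 'Z_2 A).
(** The group law is addition: [1%R] is the generator, [1%g] the neutral element. *)
Local Notation z2 := (1%R : 'Z_2).
Local Notation f := (Ainfty_act alpha z2).

Lemma Ainfty_actK : involutive f.
Proof.
move=> x; rewrite Ainfty_act_comp -[RHS](Ainfty_act1 alpha).
by congr Ainfty_act; exact: val_inj.
Qed.

Lemma bdelta_sum : bdelta R (1%g : 'Z_2) + bdelta R z2 = 1.
Proof.
apply: bfun_ext => t; rewrite -[LHS]/((t == 1%g)%:R + (t == z2)%:R : R[i]).
by case: t => [[|[|//]] lt2]; rewrite -!val_eqE /= ?addr0 ?add0r.
Qed.

Lemma tower_of_order_zero (Dinv : act_invariant alpha (full_csubalgebra A))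
    (phi : CG R 'Z_2 -> Fcentral (full_csubalgebra A)) :
    cpc_order_zero phi ->
    (forall g c, phi (left_translation g c) = Fcentral_act Dinv g (phi c)) ->
  odd_tower f (unkappa (phi (bdelta R 1%g))) (unkappa (phi (bdelta R z2))).
Proof.
move=> [phi_lin phi_cp _ phi_oz] phi_equi; split.
- rewrite -unkappa_star completely_positive_star //; exact: positive_bdelta.
- by rewrite /= -(unkappa_act Dinv) -phi_equi left_translation_bdelta mulg1.
- rewrite -unkappaM phi_oz ?unkappa0 //; [exact: positive_bdelta|exact: positive_bdelta|].
  by rewrite bdeltaM.
Qed.

(** The symmetry is W = S Y^-1, where S^2 = Y^2 and the element Y is invertible, fixed by [f] and
    commutes with [S]. *)
Lemma odd_symmetry_of_towers :
    separable A -> absorbs_UHF_2infty A -> rokhlin_towers alpha 1 ->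
  exists W : Ainfty A, [/\ star W = W, W * W = 1, f W = - W
    & forall a, GRing.comm W (Ainfty_cst a)].
Proof.
move=> sepA absA towers.
have Dinv : act_invariant alpha (full_csubalgebra A) by [].
have [phi [phi_oz phi_equi phi_comm phi_sum]] := towers _ (full_sigma_unital A) Dinv.
pose i0 : 'I_2 := ord0; pose i1 : 'I_2 := lift ord0 ord0.
pose e0 := unkappa (phi i0 (bdelta R 1%g)); pose e1 := unkappa (phi i0 (bdelta R z2)).
pose k0 := unkappa (phi i1 (bdelta R 1%g)); pose k1 := unkappa (phi i1 (bdelta R z2)).
have et : odd_tower f e0 e1 := tower_of_order_zero (phi_oz i0) (phi_equi i0).
have kt : odd_tower f k0 k1 := tower_of_order_zero (phi_oz i1) (phi_equi i1).
have ek e k : e \in [:: e0; e1] -> k \in [:: k0; k1] -> GRing.comm e k.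
  have h c d : GRing.comm (unkappa (phi i0 c)) (unkappa (phi i1 d)).
    by rewrite /GRing.comm -!unkappaM phi_comm.
  by rewrite !inE => /orP[]/eqP-> /orP[]/eqP->; exact: h.
have sum1 : (e0 + e1) + (k0 + k1) = 1.
  have phi1 i : unkappa (phi i (bdelta R 1%g)) + unkappa (phi i (bdelta R z2)) =
      unkappa (phi i 1).
    by have [[phiD _] _ _ _] := phi_oz i; rewrite -unkappaD -phiD bdelta_sum.
  rewrite [e0 + e1]phi1 [k0 + k1]phi1 -unkappaD -(unkappa1 A) -phi_sum.
  by rewrite big_ord_recl big_ord_recl big_ord0 addr0.
have ecst e a : e \in [:: e0; e1; k0; k1] -> GRing.comm e (Ainfty_cst a).
  by rewrite !inE => /or4P[]/eqP->; exact: unkappa_comm.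
have [s [t [st stc]]] := diagonal_pauli [:: e0; e1; k0; k1] sepA absA.
have [s' [t' [st' stc']]] :=
  diagonal_pauli [:: e0; e1; k0; k1; s; t; f s; f t] sepA absA.
have [S [Ss fS SS Scomm]] := odd_symmetry_square (Ainfty_act_starhom alpha z2) Ainfty_actK
  et kt ek st st' (fun p e pm => (stc p pm).2 e) (fun p e pm => (stc' p pm).2 e).
(* Commuting with [f v] is traded for [f z] commuting with [v]; the two kinds of [z] used below,
   tower elements and constants, are stable under [f]. *)
have Scomm2 z : (forall w, w \in [:: z; f z] ->
    forall v, v \in [:: e0; e1; k0; k1; s; t; s'; t'] -> GRing.comm w v) -> GRing.comm z S.
  move=> zw; have zv := zw z (mem_head _ _).
  have fzv v : v \in [:: e0; e1; k0; k1; s; t; s'; t'] -> GRing.comm z (f v).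
    move=> vm; apply: commr_sym; apply: (comm_rmorph Ainfty_actK); apply: commr_sym.
    by apply: zw; rewrite // !inE eqxx orbT.
  apply: Scomm => v; rewrite !inE => /orP[/eqP->|/orP[/eqP->|/orP[/eqP->|/orP[/eqP->|
    /orP[/eqP->|/orP[/eqP->|/orP[/eqP->|/orP[/eqP->|/or4P[]/eqP->]]]]]]]];
    by [apply: zv; rewrite !inE eqxx ?orbT|apply: fzv; rewrite !inE eqxx ?orbT].
have memE z : z \in [:: e0; e1; k0; k1] -> f z \in [:: e0; e1; k0; k1].
  have fe0 := tower_swap et; have fk0 := tower_swap kt.
  rewrite !inE => /or4P[]/eqP->; rewrite ?fe0 ?fk0 ?eqxx ?orbT //.
    by rewrite -fe0 Ainfty_actK eqxx.
  by rewrite -fk0 Ainfty_actK eqxx ?orbT.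
have pauliP p : p \in [:: s; t] \/ p \in [:: s'; t'] ->
    (forall a, GRing.comm p (Ainfty_cst a)) /\
    (forall e, e \in [:: e0; e1; k0; k1] -> GRing.comm p e).
  case=> [/stc//|/stc'[pa pe]]; split=> // e em; apply: pe.
  by move: em; rewrite !inE => /or4P[]/eqP->; rewrite eqxx ?orbT.
have split8 v : v \in [:: e0; e1; k0; k1; s; t; s'; t'] ->
    v \in [:: e0; e1; k0; k1] \/ (v \in [:: s; t] \/ v \in [:: s'; t']).
  by rewrite -[_ :: _]/([:: e0; e1; k0; k1] ++ [:: s; t] ++ [:: s'; t']) !mem_cat
    => /orP[|/orP[]]; auto.
have cst_comm a v : v \in [:: e0; e1; k0; k1; s; t; s'; t'] ->
    GRing.comm (Ainfty_cst a) v.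
  by case/split8 => [/ecst va|/pauliP[va _]]; exact/commr_sym/va.
(* Applying [f] to e e' = 0 gives e' e = 0. *)
have orth e e' : e * e' = 0 -> f e = e' -> f e' = e -> GRing.comm e e'.
  move=> ee' fe fe'; have := congr1 f ee'.
  by rewrite rmorphM rmorph0 /= fe fe' /GRing.comm ee'.
have Ecomm e v : e \in [:: e0; e1; k0; k1] ->
    v \in [:: e0; e1; k0; k1; s; t; s'; t'] -> GRing.comm e v.
  move=> em /split8[vm|/pauliP[_ ve]]; last exact/commr_sym/ve.
  have fe0 := tower_swap et; have fk0 := tower_swap kt.
  have fe1 : f e1 = e0 by rewrite -fe0 Ainfty_actK.
  have fk1 : f k1 = k0 by rewrite -fk0 Ainfty_actK.
  have c01 := orth _ _ (tower_orth et) fe0 fe1.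
  have d01 := orth _ _ (tower_orth kt) fk0 fk1.
  move: em vm; rewrite !inE => /or4P[]/eqP-> /or4P[]/eqP->; rewrite ?commr_refl //;
    try (by apply: ek; rewrite !inE eqxx ?orbT);
    try (by apply: commr_sym; apply: ek; rewrite !inE eqxx ?orbT);
    exact: commr_sym.
(* The two sums add up to 1, so by the parallelogram identity 1 + D^2 is twice the sum [Y] of their
   squares; inverting 1 + D^2 therefore inverts [Y]. *)
pose D := (e0 + e1) - (k0 + k1).
have Es : star (e0 + e1) = e0 + e1.
  by rewrite starD -(tower_swap et) -Ainfty_act_star (tower_star et).
have Ks : star (k0 + k1) = k0 + k1.
  by rewrite starD -(tower_swap kt) -Ainfty_act_star (tower_star kt).
have Ef : f (e0 + e1) = e0 + e1.
  by rewrite rmorphD -(tower_swap et) /= Ainfty_actK addrC.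
have Kf : f (k0 + k1) = k0 + k1.
  by rewrite rmorphD -(tower_swap kt) /= Ainfty_actK addrC.
have Ds : star D = D by rewrite starB Es Ks.
have Df : f D = D by rewrite /D rmorphB /= Ef Kf.
have [g [ug gu]] := Ainfty_one_plus_sq_inv Ds.
set u := 1 + D * D in ug gu.
have us : star u = u by rewrite starD starM star1 Ds.
have uf : f u = u by rewrite rmorphD rmorphM rmorph1 /= Df.
have gs : star g = g.
  have gu' : star g * u = 1 by rewrite -us -starM ug star1.
  by rewrite -[LHS]mulr1 -ug mulrA gu' mul1r.
have gf : f g = g.
  have gu' : f g * u = 1 by rewrite -uf -rmorphM gu rmorph1.
  by rewrite -[LHS]mulr1 -ug mulrA gu' mul1r.
have comm_g z : GRing.comm z u -> GRing.comm z g.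
  move=> zu; rewrite /GRing.comm -[z * g]mul1r -gu -!mulrA [u * (z * g)]mulrA.
  by rewrite -zu -mulrA ug mulr1.
have comm_u z : GRing.comm z (e0 + e1) -> GRing.comm z (k0 + k1) -> GRing.comm z u.
  move=> ze zk; have zD : GRing.comm z D by exact: commrB.
  by apply: commrD; [exact: commr1|exact: commrM].
set Y := (e0 + e1) * (e0 + e1) + (k0 + k1) * (k0 + k1) in SS.
have Y2 : Y + Y = u.
  have -> : u = ((e0 + e1) + (k0 + k1)) * ((e0 + e1) + (k0 + k1)) + D * D.
    by rewrite sum1 mulr1.
  rewrite /D /Y; move: (e0 + e1) (k0 + k1) => a b.
  have -> : (a + b) * (a + b) = (a * a + b * b) + (a * b + b * a).
    by rewrite mulrDl !mulrDr [b * a + _]addrC addrACA.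
  have -> : (a - b) * (a - b) = (a * a + b * b) - (a * b + b * a).
    by rewrite mulrBl !mulrBr opprB addrACA [- _ - _]addrC -opprD [b * a + _]addrC.
  by rewrite [RHS]addrACA subrr addr0.
pose h := g + g.
have Yh : Y * h = 1 by rewrite mulrDr -mulrDl Y2.
have SE : GRing.comm S (e0 + e1) /\ GRing.comm S (k0 + k1).
  have both z : z \in [:: e0; e1; k0; k1] -> GRing.comm z S.
    move=> zm; apply: Scomm2 => w; rewrite !inE => /orP[]/eqP-> v; last first.
      exact: Ecomm (memE _ zm).
    exact: Ecomm zm.
  by split; rewrite /GRing.comm mulrDr mulrDl;
     congr (_ + _); apply/esym/both; rewrite !inE eqxx ?orbT.
have Sh : GRing.comm S h by apply: commrD; apply: comm_g; apply: comm_u; case: SE.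
exists (S * h); split.
- by rewrite starM Ss starD gs -/h Sh.
- by rewrite -mulrA [h * _]mulrA -Sh -mulrA mulrA SS -mulrA [Y * (h * h)]mulrA Yh mul1r.
- by rewrite rmorphM rmorphD /= fS gf mulNr.
move=> a; apply: commr_sym; apply: commrM.
  apply: Scomm2 => w; rewrite !inE => /orP[]/eqP->; rewrite ?Ainfty_act_cst => v vm;
    exact: cst_comm.
have ca e : e \in [:: e0; e1; k0; k1] -> GRing.comm (Ainfty_cst a) e.
  by move=> em; apply: commr_sym; exact: ecst.
apply: commrD; apply: comm_g; apply: comm_u; apply: commrD; apply: ca;
  by rewrite !inE eqxx ?orbT.
Qed.

End OddSymmetryFromTowers.

(** * From the odd symmetry to the Rokhlin property *)

Section RokhlinTower.
Variables (R : realType).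

Lemma starhom_completely_positive (B F : normedStarAlgType R)
    (h : {rmorphism B -> F}) : starhom h -> completely_positive h.
Proof.
move=> [_ hs] n X [Y ->]; exists (map_mx h Y).
apply/matrixP => i j; rewrite !mxE rmorph_sum.
by apply: eq_bigr => k _; rewrite !mxE rmorphM hs.
Qed.

Lemma starhom_clinear (B F : normedStarAlgType R) (h : {rmorphism B -> F}) :
  starhom h -> clinear h.
Proof.
move=> [hscal _]; split=> [x y|c x]; first exact: rmorphD.
by rewrite rmorphM hscal.
Qed.

Lemma starhom_order_zero (B F : normedStarAlgType R) (h : {rmorphism B -> F}) :
  order_zero h.
Proof. by move=> c1 c2 _ _ c12; rewrite -rmorphM c12 rmorph0. Qed.

Variables (A : cstarAlgType R) (alpha : cstar_action 'Z_2 A).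
Local Notation z2 := (1%R : 'Z_2).
Local Notation f := (Ainfty_act alpha z2).
Variable W : Ainfty A.
Hypotheses (W_star : star W = W) (WW : W * W = 1) (W_odd : f W = - W)
  (W_cst : forall a, GRing.comm W (Ainfty_cst a)).
Local Notation C2 := (CG R 'Z_2).

(** With [odd_part], the coordinates of [c] in the basis 1, w of C(Z_2), where w is the character
    with values 1 and -1; [symmetry_eval] sends w to [W]. *)
Definition even_part (c : C2) : R[i] := (c 1%g + c z2) / 2.
Definition odd_part (c : C2) : R[i] := (c 1%g - c z2) / 2.
(* the value [c 1 * (1 + W) / 2 + c z2 * (1 - W) / 2] *)
Definition symmetry_eval (c : C2) : Ainfty A :=
  scal (even_part c) + scal (odd_part c) * W.

Lemma cnorm_Ainfty1_le : cnorm (1 : Ainfty A) <= 1.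
Proof.
rewrite -(rmorph1 (@etaA R A)); apply: (le_trans (qnorm_lb _ _)).
by apply: bnorm_le => // n; exact: cnorm1_le.
Qed.

Lemma cnorm_symmetry_le1 : cnorm W <= 1.
Proof.
have h : cnorm W ^+ 2 <= 1.
  by apply: (le_trans (Ainfty_cnorm_sq _)); rewrite W_star WW cnorm_Ainfty1_le.
by rewrite -(@expr_le1 _ 2) // cnorm_ge0.
Qed.

Lemma symmetry_evalB c d : symmetry_eval (c - d) = symmetry_eval c - symmetry_eval d.
Proof.
rewrite /symmetry_eval.
have -> : even_part (c - d) = even_part c - even_part d.
  rewrite /even_part -[(c - d) 1%g]/(c 1%g - d 1%g).
  by rewrite -[(c - d) z2]/(c z2 - d z2); field.
have -> : odd_part (c - d) = odd_part c - odd_part d.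
  rewrite /odd_part -[(c - d) 1%g]/(c 1%g - d 1%g).
  by rewrite -[(c - d) z2]/(c z2 - d z2); field.
by rewrite !rmorphB mulrBl opprD addrACA.
Qed.

Lemma symmetry_evalM c d : symmetry_eval (c * d) = symmetry_eval c * symmetry_eval d.
Proof.
rewrite /symmetry_eval.
have -> : even_part (c * d) = even_part c * even_part d + odd_part c * odd_part d.
  rewrite /even_part /odd_part -[(c * d) 1%g]/(c 1%g * d 1%g).
  by rewrite -[(c * d) z2]/(c z2 * d z2); field.
have -> : odd_part (c * d) = even_part c * odd_part d + odd_part c * even_part d.
  rewrite /even_part /odd_part -[(c * d) 1%g]/(c 1%g * d 1%g).
  by rewrite -[(c * d) z2]/(c z2 * d z2); field.
move: (even_part c) (odd_part c) (even_part d) (odd_part d) => p q r s.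
rewrite [RHS]mulrDl [X in _ = X + _]mulrDr [X in _ = _ + X]mulrDr.
rewrite [scal q * W * (scal s * W)]mulr_scal WW mulr1.
rewrite -[scal q * W * scal r]mulrA -[W * scal r]scalC.
rewrite [scal p * (scal s * W)]mulrA [scal q * (scal r * W)]mulrA.
rewrite -!(rmorphM (@scal R (Ainfty A))).
by rewrite [X in _ = _ + X]addrC addrACA -mulrDl -!(rmorphD (@scal R (Ainfty A))).
Qed.

Lemma symmetry_eval1 : symmetry_eval 1 = 1.
Proof.
rewrite /symmetry_eval.
have -> : even_part 1 = 1.
  by rewrite /even_part -[_ 1%g]/(1 : R[i]) -[_ z2]/(1 : R[i]); field.
have -> : odd_part 1 = 0.
  by rewrite /odd_part -[_ 1%g]/(1 : R[i]) -[_ z2]/(1 : R[i]); field.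
by rewrite rmorph1 rmorph0 mul0r addr0.
Qed.

Lemma symmetry_eval_scal (k : R[i]) : symmetry_eval (scal k) = scal k.
Proof.
rewrite /symmetry_eval.
have -> : even_part (scal k) = k by rewrite /even_part -[_ 1%g]/k -[_ z2]/k; field.
have -> : odd_part (scal k) = 0 by rewrite /odd_part -[_ 1%g]/k -[_ z2]/k; field.
by rewrite rmorph0 mul0r addr0.
Qed.

Lemma symmetry_eval_star c : symmetry_eval (star c) = star (symmetry_eval c).
Proof.
rewrite /symmetry_eval starD starM !star_scal W_star -scalC.
have -> : even_part (star c) = Num.conj (even_part c).
  by rewrite /even_part fmorph_div rmorphD rmorph_nat.
have -> : odd_part (star c) = Num.conj (odd_part c).
  by rewrite /odd_part fmorph_div rmorphB rmorph_nat.
by [].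
Qed.

(** Translation by the generator changes the sign of the odd part, as [f] does with [W]. *)
Lemma symmetry_eval_act g c :
  symmetry_eval (left_translation g c) = Ainfty_act alpha g (symmetry_eval c).
Proof.
have [->|->] : g = 1%g \/ g = z2.
  by case: g => [[|[|//]] lt2]; [left|right]; exact: val_inj.
  rewrite Ainfty_act1; congr symmetry_eval.
  by apply: bfun_ext => t; rewrite -[LHS]/(c _) invg1 mul1g.
rewrite /symmetry_eval.
have -> : scal (odd_part c) * W = - (scal (- odd_part c) * W).
  by rewrite rmorphN mulNr opprK.
rewrite Ainfty_actB Ainfty_actM !Ainfty_act_scal W_odd mulrN opprK.
have c1 : left_translation z2 c 1%g = c z2 by congr (bfun_val c _); exact: val_inj.
have c2 : left_translation z2 c z2 = c 1%g by congr (bfun_val c _); exact: val_inj.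
congr (scal _ + scal _ * W); first by rewrite /even_part c1 c2 addrC.
by rewrite /odd_part c1 c2 -mulNr opprB.
Qed.

Lemma symmetry_eval_comm c a : GRing.comm (symmetry_eval c) (Ainfty_cst a).
Proof.
apply: commr_sym; apply: commrD; first by rewrite /GRing.comm scalC.
apply: commrM; first by rewrite /GRing.comm scalC.
exact/commr_sym/W_cst.
Qed.

(** The triangle inequality on [c] itself may lose a factor. On the nonnegative function
    [star c * c] it is sharp: the moduli of the parts (U + V) / 2 and (U - V) / 2 add up to the
    maximum of U and V. *)
Lemma cnorm_symmetry_eval_le c : cnorm (symmetry_eval c) <= cnorm c.
Proof.
rewrite -(@ler_pXn2r _ 2) ?nnegrE ?cnorm_ge0 //.
apply: (le_trans (Ainfty_cnorm_sq _)); rewrite -symmetry_eval_star -symmetry_evalM.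
pose m : R := cnorm c; pose u := modulus (c 1%g); pose v := modulus (c z2).
have um : u <= m := bnorm_ub c 1%g.
have vm : v <= m := bnorm_ub c z2.
have half (r : R) : r%:C%C / 2 = (r / 2)%:C%C :> R[i].
  by rewrite [RHS]rmorphM fmorphV rmorph_nat.
have sqE t : (star c * c) t = (modulus (c t) ^+ 2)%:C%C.
  by rewrite rmorphXn /= modulusE normCKC.
have evE : even_part (star c * c) = ((u ^+ 2 + v ^+ 2) / 2)%:C%C.
  by rewrite /even_part !sqE -half rmorphD.
have odE : odd_part (star c * c) = ((u ^+ 2 - v ^+ 2) / 2)%:C%C.
  by rewrite /odd_part !sqE -half rmorphB.
have u0 : 0 <= u := modulus_ge0 _; have v0 : 0 <= v := modulus_ge0 _.
have um2 : u ^+ 2 <= m ^+ 2 by rewrite ler_pXn2r ?nnegrE // (le_trans u0).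
have vm2 : v ^+ 2 <= m ^+ 2 by rewrite ler_pXn2r ?nnegrE // (le_trans u0).
rewrite /symmetry_eval evE odE; apply: (le_trans (cnormD _ _)).
rewrite -[X in cnorm X + _]mulr1 !cnormZ !modulus_real.
have le_norm (r : R) (x : Ainfty A) : cnorm x <= 1 -> `|r| * cnorm x <= `|r|.
  by move=> x1; rewrite ler_piMr.
apply: (le_trans (lerD (le_norm _ _ cnorm_Ainfty1_le) (le_norm _ _ cnorm_symmetry_le1))).
rewrite ger0_norm ?divr_ge0 ?addr_ge0 ?sqr_ge0 //.
move: um2 vm2; rewrite -/m; move: (u ^+ 2) (v ^+ 2) (m ^+ 2) => U V M UM VM.
by case: ger0P => _; lra.
Qed.

(** As [W] commutes with all of [A], evaluation at [W] followed by [kappa] is, for every [D], a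
    unital equivariant *-homomorphism, hence a completely positive contractive order zero map. *)
Lemma symmetry_rokhlin_towers : rokhlin_towers alpha 0.
Proof.
move=> D _ Dinv.
have comm_subproof c : commutes_with D (symmetry_eval c).
  by apply/asboolP => d _; exact: symmetry_eval_comm.
pose psi c : Fcentral D := kappa (Commutant (comm_subproof c)).
have psi_zmod : zmod_morphism psi.
  move=> c d; rewrite /psi -rmorphB /=; congr kappa; apply: val_inj.
  exact: symmetry_evalB.
have psi_monoid : monoid_morphism psi.
  split=> [|c d].
    rewrite -[RHS](rmorph1 (@kappa R A D)); congr kappa; apply: val_inj.
    exact: symmetry_eval1.
  rewrite /psi -rmorphM /=; congr kappa; apply: val_inj; exact: symmetry_evalM.
pose Psi : {rmorphism CG R 'Z_2 -> Fcentral D} := HB.pack psi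
  (GRing.isZmodMorphism.Build _ _ psi psi_zmod)
  (GRing.isMonoidMorphism.Build _ _ psi psi_monoid).
have Psi_hom : starhom Psi.
  split=> [k|c].
    rewrite -[RHS]/(kappa (scal k)) -[LHS]/(psi _) /psi; congr kappa; apply: val_inj.
    exact: symmetry_eval_scal.
  rewrite -[RHS]/(star (psi _)) -[LHS]/(psi _) /psi -kappa_star; congr kappa.
  by apply: val_inj; exact: symmetry_eval_star.
exists (fun=> psi); split.
- move=> _; split.
  + exact: starhom_clinear Psi_hom.
  + exact: starhom_completely_positive Psi_hom.
  + by move=> c; apply: (le_trans (qnorm_lb _ _)); exact: cnorm_symmetry_eval_le.
  + exact: (@starhom_order_zero _ _ Psi).
- move=> _ g c; rewrite /psi Fcentral_act_kappa; congr kappa; apply: val_inj.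
  exact: symmetry_eval_act.
- by move=> i j; rewrite (ord1 i) (ord1 j) eqxx.
- by rewrite big_ord1 psi_monoid.1.
Qed.

End RokhlinTower.

Section Dimension.
Variables (R : realType) (gT : finGroupType) (A : cstarAlgType R).
Variable alpha : cstar_action gT A.

Lemma rokhlin_property_of_towers : rokhlin_towers alpha 0 -> rokhlin_property alpha.
Proof.
move=> towers; apply/eqP; rewrite eq_le; apply/andP; split.
  by apply: ereal_inf_lbound; exists 0%N.
by apply: le_ereal_inf_tmp => _ [d _ <-]; rewrite lee_fin.
Qed.

(** If neither 0 nor 1 were admissible, the infimum would be at least 2, also over the empty set. *)
Lemma dimRokc_le1 : (dimRokc alpha <= 1%:E)%E ->
  rokhlin_towers alpha 0 \/ rokhlin_towers alpha 1.
Proof.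
move=> dim1; apply: contrapT => /not_orP[no0 no1].
have : (2%:E <= dimRokc alpha)%E.
  apply: le_ereal_inf_tmp => _ [d towers <-]; rewrite lee_fin ler_nat.
  by case: d towers => [|[|]].
by move/le_trans/(_ dim1); rewrite lee_fin lt_geF // ltr1n.
Qed.

End Dimension.

Theorem theorem3p34 (R : realType) (A : cstarAlgType R)
    (alpha : cstar_action 'Z_2 A) :
  separable A ->
  (dimRokc alpha <= 1%:E)%E ->
  absorbs_UHF_2infty A ->
  rokhlin_property alpha.
Proof.
move=> sepA /dimRokc_le1[towers _|towers absA]; first exact: rokhlin_property_of_towers.
have [W [Ws WW Wf Wcst]] := odd_symmetry_of_towers sepA absA towers.
exact/rokhlin_property_of_towers/(symmetry_rokhlin_towers Ws WW Wf Wcst).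
Qed.
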